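(* Let $<_D$ be the Dehornoy ordering of the braid group $B_n$. Then for each $\beta\in B_n^{+}$, the $\mathcal{C}$-normal form $W(\beta;<_D)$ of $\beta$ with respect to the ordering $<_D$ coincides with Dehornoy's $\Phi$-normal form of $\beta$ (as positive words).
   Context: $B_n$ ($n\ge2$) is the braid group with Artin generators $\sigma_1,\dots,\sigma_{n-1}$, and $B_n^+$ is the submonoid generated by them. $\langle\dots\rangle$ applied to a list of generators denotes the submonoid they generate (or the words in these letters). The Dehornoy ordering: $\alpha<_D\beta$ iff $\alpha^{-1}\beta$ admits, for some $i$, a word representative containing no $\sigma_1^{\pm1},\dots,\sigma_{i-1}^{\pm1},\sigma_i^{-1}$ but at least one $\sigma_i$; it is the normal finite Thurston type ordering corresponding to the identity permutation $(k(1),\dots,k(n-1))=(1,\dots,n-1)$. Put $D(\sigma_r)=\sigma_{n-r}$ and $Sh(\sigma_r)=\sigma_{r-1}$. **Codes with respect to $<_D$, by induction on $n$.** (This is the paper's general definition of codes specialized to the identity permutation, for which the numbers $m_j,M_j$ of the general definition are $m_j=j+1$, $M_j=n$, and all restricted orderings are again Dehornoy orderings.) For $n=2$ the code of $\sigma_1^a$ is $(a)$. For $n\ge3$, a tower of subword decompositions of a positive $n$-braid word $W$ is a factorization (of words, possibly with empty factors) $W=A_mA_{m-1}\cdots A_0A_{-1}$ with $A_{-1}\in\langle\sigma_2,\dots,\sigma_{n-1}\rangle$, $A_i\in\langle\sigma_1,\dots,\sigma_{n-2}\rangle$ for odd $i>0$, $A_i\in\langle\sigma_2,\dots,\sigma_{n-1}\rangle$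 for even $i\ge0$, a factorization $A_{-1}=X_1X_2\cdots X_{n-2}$ with $X_j\in\langle\sigma_{j+1},\dots,\sigma_{n-1}\rangle$, and (recursively) towers for the words below. For $i>0$, $\mathcal{C}_i$ is the code of the $(n-1)$-braid word $D^{i-1}(A_i)$; $\mathcal{C}_0$ is the code of the $(n-1)$-braid word $Sh(A_0)$; for $1\le j\le n-2$, $\mathcal{C}_{-j}$ is the code of the $(n-j)$-braid word $Sh^{j}(X_j)$; all with respect to Dehornoy orderings. The code of $W$ with its tower is the left-infinite sequence $(\dots,\mathcal{C}_i,\dots,\mathcal{C}_0,\mathcal{C}_{-1},\dots,\mathcal{C}_{-(n-2)})$, where $\mathcal{C}_i$ is the trivial code (code of the empty word, all zeros) for $i>m$. **$\mathcal{C}$-normal form.** For $n=2$, $(a)<_{\mathrm{right}}(b)\iff a<b$. For $n\ge3$, $\mathcal{C}<_{\mathrm{right}}\mathcal{C}'$ if for some $l\ge-(n-2)$, $\mathcal{C}_i=\mathcal{C}'_i$ for all $i<l$ and $\mathcal{C}_l<_{\mathrm{right}}\mathcal{C}'_l$. The $\mathcal{C}$-normal form $W(\beta;<_D)$ of $\beta\in B_n^+$ is the positive word representing $\beta$ which has a tower whose code is $<_{\mathrm{right}}$-maximal among all codes of positive words representing $\beta$ (over all towers). **$\Phi$-normal form (alternate normal form).** For a set $S$ of generators, $\beta\wedge\langle S\rangle$ denotes the maximal right divisor of $\beta$ in $\langle S\rangle$: the unique $\beta'\in\langle S\rangle$ with $\beta\beta'^{-1}\in B_n^+$ such that, for $\beta''\in\langle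 S\rangle$, $\beta\beta''^{-1}\in B_n^+$ implies $\beta'\beta''^{-1}\in\langle S\rangle$. For $n=2$ the $\Phi$-normal form of $\sigma_1^p$ is $\sigma_1^p$. For $n\ge3$ let $B_I^+=\langle\sigma_2,\dots,\sigma_{n-1}\rangle$, $B_J^+=\langle\sigma_1,\dots,\sigma_{n-2}\rangle$. The alternate decomposition $\beta=\beta_m\beta_{m-1}\cdots\beta_0$ is defined by $\beta_0=\beta\wedge B_I^+$ and, for $i\ge1$, $\beta_i=(\beta\beta_0^{-1}\cdots\beta_{i-1}^{-1})\wedge B_J^+$ if $i$ is odd and $\beta_i=(\beta\beta_0^{-1}\cdots\beta_{i-1}^{-1})\wedge B_I^+$ if $i$ is even. Identify each $\beta_i$ with an element of $B_{n-1}^+$ by the identity for odd $i$, by $D$ for even $i>0$, and by $Sh$ for $i=0$; replacing each $\beta_i$ by its $\Phi$-normal form under this identification (recursively) and concatenating gives the $\Phi$-normal form of $\beta$. *)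

(* Defs.v *)
From HB Require Import structures.
From mathcomp Require Import all_boot.
From mathcomp Require Import boolp.

Set Implicit Arguments.
Unset Strict Implicit.
Unset Printing Implicit Defensive.

Local Open Scope quotient_scope.
Local Open Scope group_scope.
Local Open Scope nat_scope.

Definition artin_index (n : nat) : Type := {r : nat | 0 < r < n}.

(* (i, true) is the letter sigma_i and (i, false) the letter sigma_i^-1. *)
Definition signed_word (n : nat) : Type := seq (artin_index n * bool).

Inductive artin_relation (n : nat) : signed_word n -> signed_word n -> Prop :=
| artin_free i e : artin_relation [:: (i, e); (i, ~~ e)] [::]
| artin_far i j : val i + 2 <= val j ->
    artin_relation [:: (i, true); (j, true)] [:: (j, true); (i, true)]
| artin_near i j : val j = val i + 1 ->
    artin_relation [:: (i, true); (j, true); (i, true)]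
                   [:: (j, true); (i, true); (j, true)].

Inductive artin_equiv (n : nat) : signed_word n -> signed_word n -> Prop :=
| artin_step x u v y :
    artin_relation u v -> artin_equiv (x ++ u ++ y) (x ++ v ++ y)
| artin_refl u : artin_equiv u u
| artin_sym u v : artin_equiv u v -> artin_equiv v u
| artin_trans u v w : artin_equiv u v -> artin_equiv v w -> artin_equiv u w.

Definition artin_equivb (n : nat) : rel (signed_word n) :=
  fun u v => `[< artin_equiv u v >].

Lemma artin_equivb_equiv n : equiv_class_of (@artin_equivb n).
Proof.
split=> [u|u v|v u w].
- exact/asboolP/artin_refl.
- by apply/asboolP/asboolP; apply: artin_sym.
- by move=> /asboolP uv /asboolP vw; apply/asboolP; apply: artin_trans uv vw.
Qed.

Canonical artin_equivb_canonical n := EquivRelPack (artin_equivb_equiv n).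

Definition braid_group (n : nat) : Type :=
  {eq_quot artin_equivb_canonical n}.
HB.instance Definition _ n := Choice.on (braid_group n).

Definition signed_braid (n : nat) (u : signed_word n) : braid_group n :=
  \pi_(braid_group n) u.

Lemma signed_braidP n (u v : signed_word n) :
  signed_braid u = signed_braid v <-> artin_equiv u v.
Proof. by split=> [/eqmodP/asboolP //|uv]; apply/eqmodP/asboolP. Qed.

Lemma signed_braid_surj n (b : braid_group n) : signed_braid (repr b) = b.
Proof. exact: reprK. Qed.

Definition signed_inv n (u : signed_word n) : signed_word n :=
  rev [seq (x.1, ~~ x.2) | x <- u].

Definition braid_one n : braid_group n := signed_braid [::].
Definition braid_mul n (a b : braid_group n) : braid_group n :=
  signed_braid (repr a ++ repr b).
Definition braid_inv n (a : braid_group n) : braid_group n :=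
  signed_braid (signed_inv (repr a)).

Lemma artin_cat2l n (x u v : signed_word n) :
  artin_equiv u v -> artin_equiv (x ++ u) (x ++ v).
Proof.
elim=> {u v} [y u v z uv|u|u v _|u v w _ uv _ vw].
- by rewrite !(catA x); apply: artin_step.
- exact: artin_refl.
- exact: artin_sym.
- exact: artin_trans uv vw.
Qed.

Lemma artin_cat2r n (x u v : signed_word n) :
  artin_equiv u v -> artin_equiv (u ++ x) (v ++ x).
Proof.
elim=> {u v} [y u v z uv|u|u v _|u v w _ uv _ vw].
- by rewrite -!catA; apply: artin_step.
- exact: artin_refl.
- exact: artin_sym.
- exact: artin_trans uv vw.
Qed.

Lemma signed_invK n : involutive (@signed_inv n).
Proof.
move=> u; rewrite /signed_inv map_rev revK -map_comp -[RHS]map_id.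
by apply: eq_map => -[i e] /=; rewrite negbK.
Qed.

Lemma artin_mulwV n (u : signed_word n) : artin_equiv (u ++ signed_inv u) [::].
Proof.
elim: u => [|[i e] u IHu]; first exact: artin_refl.
rewrite /signed_inv /= rev_cons -cats1 catA -/(signed_inv u).
apply: artin_trans
  (_ : artin_equiv ([:: (i, e)] ++ [::] ++ [:: (i, ~~ e)]) _).
  by apply: (@artin_cat2l _ [:: (i, e)]); apply: artin_cat2r.
exact: (@artin_step _ [::] [:: (i, e); (i, ~~ e)] [::] [::] (artin_free i e)).
Qed.

Lemma signed_braidM n (u v : signed_word n) :
  braid_mul (signed_braid u) (signed_braid v) = signed_braid (u ++ v).
Proof.
apply/signed_braidP.
apply: artin_trans (artin_cat2r _ _) (artin_cat2l _ _);
  by apply/signed_braidP; rewrite signed_braid_surj.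
Qed.

Lemma braid_mulA n : associative (@braid_mul n).
Proof.
move=> a b c; rewrite -(signed_braid_surj a) -(signed_braid_surj b).
by rewrite -(signed_braid_surj c) !signed_braidM catA.
Qed.

Lemma braid_mul1 n : left_id (braid_one n) (@braid_mul n).
Proof. by move=> a; rewrite -(signed_braid_surj a) signed_braidM. Qed.

Lemma braid_mulr1 n : right_id (braid_one n) (@braid_mul n).
Proof. by move=> a; rewrite -(signed_braid_surj a) signed_braidM cats0. Qed.

Lemma braid_mulV n : left_inverse (braid_one n) (@braid_inv n) (@braid_mul n).
Proof.
move=> a; rewrite -{2}(signed_braid_surj a) signed_braidM.
by apply/signed_braidP; rewrite -{2}(signed_invK (repr a)); apply: artin_mulwV.
Qed.

Lemma braid_mulrV n : right_inverse (braid_one n) (@braid_inv n) (@braid_mul n).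
Proof.
move=> a; rewrite -{1}(signed_braid_surj a) signed_braidM.
exact/signed_braidP/artin_mulwV.
Qed.

HB.instance Definition _ n := isGroup.Build (braid_group n)
  (@braid_mulA n) (@braid_mul1 n) (@braid_mulr1 n)
  (@braid_mulV n) (@braid_mulrV n).

(* Out-of-range indices get the junk value 1; every word below is constrained
   to letters in range. *)
Definition sigma (n r : nat) : braid_group n :=
  if insub r is Some i then signed_braid [:: (i : artin_index n, true)] else 1%g.

(* A positive word is the sequence of the indices of its letters; the strand
   number is kept outside, as the same letters are read in several B_k. *)
Definition word : Type := seq nat.

Definition word_braid (n : nat) (w : word) : braid_group n :=
  (\prod_(r <- w) sigma n r)%g.

Definition letters (a b : nat) : pred nat := fun r => a <= r <= b.

Definition positive_word (n : nat) (w : word) : bool := all (letters 1 n.-1) w.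

Definition submonoid (n : nat) (S : pred nat) (b : braid_group n) : Prop :=
  exists2 w : word, all S w & b = word_braid n w.

Definition positive_braid (n : nat) (b : braid_group n) : Prop :=
  submonoid (letters 1 n.-1) b.

Definition D (n r : nat) : nat := n - r.
Definition Sh (r : nat) : nat := r.-1.

Definition alt_letters (n i : nat) : pred nat :=
  if odd i then letters 1 n.-2 else letters 2 n.-1.

(* [Code2 a] is the 2-strand code (a).  For n >= 3 strands, [CodeSeq C] is the
   left-infinite sequence whose entry of index i >= -(n-2) is C (i + (n-2)):
   the rightmost entry C_{-(n-2)} is C 0 and C_0 is C (n-2). *)
Inductive code : Type :=
| Code2 of nat
| CodeSeq of (nat -> code).

(* D^{i-1} for i > 0, and Sh for i = 0. *)
Definition tower_letter (n i : nat) : nat -> nat :=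
  if i is i'.+1 then iter i' (D n) else Sh.

(* [has_code n W c]: the n-braid word W has a tower of subword decompositions
   whose code, with respect to the Dehornoy ordering, is c; a derivation is
   such a tower.  The only datum of the ordering that enters is its permutation
   (k(1), ..., k(n-1)), which is the identity here. *)
Inductive has_code : nat -> word -> code -> Prop :=
| has_code2 (a : nat) : has_code 2 (nseq a 1) (Code2 a)
| has_codeS (n m : nat) (A X : nat -> word) (C : nat -> code) :
    3 <= n ->
    (forall i, i <= m -> all (alt_letters n i) (A i)) ->
    (forall j, 1 <= j <= n - 2 -> all (letters j.+1 n.-1) (X j)) ->
    (forall i, i <= m ->
       has_code n.-1 [seq tower_letter n i r | r <- A i] (C (i + (n - 2)))) ->
    (forall i, m < i -> has_code n.-1 [::] (C (i + (n - 2)))) ->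
    (forall j, 1 <= j <= n - 2 ->
       has_code (n - j) [seq iter j Sh r | r <- X j] (C (n - 2 - j))) ->
    (* A_m ... A_0 followed by A_{-1} = X_1 ... X_{n-2} *)
    has_code n (flatten [seq A i | i <- rev (iota 0 m.+1)] ++
                flatten [seq X j | j <- iota 1 (n - 2)])
               (CodeSeq C).

(* Meaningful between codes of the same number of strands, which have the same
   shape. *)
Inductive lt_right : code -> code -> Prop :=
| lt_right2 (a b : nat) : a < b -> lt_right (Code2 a) (Code2 b)
| lt_rightS (C C' : nat -> code) (l : nat) :
    (forall i, i < l -> C i = C' i) -> lt_right (C l) (C' l) ->
    lt_right (CodeSeq C) (CodeSeq C').

Definition is_C_normal_form (n : nat) (beta : braid_group n) (W : word) : Prop :=
  [/\ positive_word n W, word_braid n W = beta &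
      exists2 c, has_code n W c &
        forall W' c', positive_word n W' -> word_braid n W' = beta ->
          has_code n W' c' -> ~ lt_right c c'].

(* [is_wedge S beta beta']: beta' is beta /\ <S>, the maximal right divisor of
   beta in <S>. *)
Definition is_wedge (n : nat) (S : pred nat) (beta beta' : braid_group n) :
    Prop :=
  [/\ submonoid S beta',
      positive_braid (beta * beta'^-1)%g &
      forall beta'', submonoid S beta'' ->
        positive_braid (beta * beta''^-1)%g ->
        submonoid S (beta' * beta''^-1)%g].

(* b i is beta_i, for i <= m; trailing trivial factors are allowed, and
   contribute empty words to the normal form. *)
Definition alternate_decomposition (n : nat) (beta : braid_group n) (m : nat)
    (b : nat -> braid_group n) : Prop :=
  beta = (\prod_(i <- rev (iota 0 m.+1)) b i)%g /\
  forall i, i <= m ->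
    is_wedge (alt_letters n i) (beta * \prod_(0 <= j < i) (b j)^-1)%g (b i).

Definition alt_letter_id (n i : nat) : nat -> nat :=
  if i == 0 then Sh else if odd i then id else D n.

(* The element g of B_{n-1}^+ identified with the i-th factor b. *)
Definition alt_identified (n i : nat) (b : braid_group n)
    (g : braid_group n.-1) : Prop :=
  exists u : word, [/\ all (alt_letters n i) u, b = word_braid n u &
    g = word_braid n.-1 [seq alt_letter_id n i r | r <- u]].

(* Only meaningful for n >= 2.  V i is the word, in the letters of the i-th
   factor, corresponding to the Phi-normal form of g i. *)
Fixpoint is_Phi_normal_form (n : nat) : braid_group n -> word -> Prop :=
  match n with
  | 0 => fun _ _ => False
  | n'.+1 => fun beta W =>
      if n' == 1 then
        exists p, beta = (sigma n'.+1 1 ^+ p)%g /\ W = nseq p 1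
      else
        exists (m : nat) (b : nat -> braid_group n'.+1)
               (g : nat -> braid_group n') (V : nat -> word),
          [/\ alternate_decomposition beta m b,
              forall i, i <= m -> alt_identified i (b i) (g i),
              forall i, i <= m -> all (alt_letters n'.+1 i) (V i),
              forall i, i <= m -> is_Phi_normal_form (g i)
                [seq alt_letter_id n'.+1 i r | r <- V i] &
              W = flatten [seq V i | i <- rev (iota 0 m.+1)]]
  end.

(* Main.v *)
Require Import Defs.
From mathcomp Require Import all_boot.
From mathcomp Require Import boolp.
From mathcomp Require Import zify.
From Stdlib Require Import Setoid Morphisms.

Set Implicit Arguments.
Unset Strict Implicit.
Unset Printing Implicit Defensive.

(** Both normal forms come from greedy factorizations, and the theorem holds
    because the two greedy procedures pick the same divisors in the same order.

    Divisibility is studied in the monoid of positive words modulo the braid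
    relations, written [==+].  Garside's key lemma [peq_last_letters] makes
    this monoid cancellative and provides the maximal right divisors
    [wedge_exists]; the central full twist, divisible by every letter, turns
    signed words into fractions, so the monoid embeds in the braid group
    [word_braid_inj].  After that the group plays no part in the argument.

    A tower of subword decompositions is read as one sequence of words, one for
    each entry of the code, numbered from the right; the position [k] is called
    a slot, and the word in it uses the letters [slot_letters n k] and is
    treated as a braid on [slot_strands n k < n] strands.  The rightmost
    entries of a code weigh most, and prolonging a word to the left enlarges
    its code ([has_code_cat]).  A tower whose code is greatest must therefore
    take, slot after slot, the maximal right divisor of what is left, and spell
    it by a word whose code on fewer strands is greatest; conversely such a
    greedy tower has the greatest code ([normal_tower_code_normal]).  As a code
    determines its word ([has_code_inj]), a positive braid is represented by
    exactly one word of greatest code.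

    The alternate normal form is greedy as well, but coarser: its rightmost
    factor is the maximal right divisor in the letters 2 to n-1, normalized on
    n-1 strands, whereas the tower fills the slots 0 to n-3 with successive
    divisors in the letters n-1, then n-2 and n-1, and so on.  These slots
    multiply to the same divisor ([first_factor_wedge]), so that slot n-2
    stays empty.  After the shift they
    form, all but the last one, the beginning of the greedy tower on n-1
    strands of that divisor; the remaining part of this tower is the greedy
    tower of the last one ([first_factor_normal]).  Hence the two
    normalizations of the rightmost factor agree by induction on n, the other
    factors are literally the same, and uniqueness of the alternate normal form
    ([Phi_word_unique]) gives the equivalence. *)

(** * Braid equivalence of positive words *)

Definition adj (i j : nat) : bool := (i.+1 == j) || (j.+1 == i).

Lemma adjC i j : adj i j = adj j i.
Proof. exact: orbC. Qed.

Lemma adj_irr i : adj i i = false.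
Proof. rewrite /adj; lia. Qed.

Lemma adj_far i j : i + 2 <= j -> ~~ adj i j.
Proof. rewrite /adj; lia. Qed.

Lemma adj_next i j : j = i + 1 -> adj i j.
Proof. rewrite /adj; lia. Qed.

(** The number of strands is absent: the braid relations preserve the set of
    letters that occur, so positive words on all numbers of strands live in a
    single monoid. *)
Inductive peq : word -> word -> Prop :=
| peq_comm x y i j :
    ~~ adj i j -> peq (x ++ [:: i; j] ++ y) (x ++ [:: j; i] ++ y)
| peq_braid x y i j :
    adj i j -> peq (x ++ [:: i; j; i] ++ y) (x ++ [:: j; i; j] ++ y)
| peq_refl u : peq u u
| peq_trans u v w : peq u v -> peq v w -> peq u w.

Infix "==+" := peq (at level 70, no associativity).

Lemma peq_sym u v : u ==+ v -> v ==+ u.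
Proof.
elim=> {u v} [x y i j ij|x y i j ij|u|u v w _ vu _ wv].
- by apply: peq_comm; rewrite adjC.
- by apply: peq_braid; rewrite adjC.
- exact: peq_refl.
- exact: peq_trans wv vu.
Qed.

Lemma peq_cat2l x u v : u ==+ v -> x ++ u ==+ x ++ v.
Proof.
elim=> {u v} [y z i j ij|y z i j ij|u|u v w _ uv _ vw].
- by rewrite !(catA x); apply: peq_comm.
- by rewrite !(catA x); apply: peq_braid.
- exact: peq_refl.
- exact: peq_trans uv vw.
Qed.

Lemma peq_cat2r x u v : u ==+ v -> u ++ x ==+ v ++ x.
Proof.
elim=> {u v} [y z i j ij|y z i j ij|u|u v w _ uv _ vw].
- by rewrite -!catA; apply: peq_comm.
- by rewrite -!catA; apply: peq_braid.
- exact: peq_refl.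
- exact: peq_trans uv vw.
Qed.

#[local] Instance peq_equivalence : Equivalence peq.
Proof. by split=> [u|u v|u v w];
  [apply: peq_refl|apply: peq_sym|apply: peq_trans]. Qed.

#[local] Instance peq_cat : Proper (peq ==> peq ==> peq) (@cat nat).
Proof.
by move=> u u' uu' v v' vv';
  apply: peq_trans (peq_cat2r _ uu') (peq_cat2l _ vv').
Qed.

#[local] Hint Resolve peq_refl : core.

#[local] Instance peq_cons i : Proper (peq ==> peq) (cons i).
Proof. by move=> u v; apply: (peq_cat2l [:: i]). Qed.

Lemma peq_size u v : u ==+ v -> size u = size v.
Proof.
elim=> {u v} [x y i j _|x y i j _|//|u v w _ -> _ ->//]; by rewrite !size_cat.
Qed.

Lemma peq_nil u : u ==+ [::] -> u = [::].
Proof. by move/peq_size/size0nil. Qed.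

Lemma peq_all (S : pred nat) u v : u ==+ v -> all S u = all S v.
Proof.
elim=> {u v} [x y i j _|x y i j _|//|u v w _ -> _ ->//]; rewrite !all_cat /=.
  by rewrite !andbT (andbC (S i)).
by case: (S i); case: (S j).
Qed.

Lemma peq_rev u v : u ==+ v -> rev u ==+ rev v.
Proof.
elim=> {u v} [x y i j ij|x y i j ij|u|u v w _ uv _ vw].
- by rewrite !rev_cat -!catA; apply: peq_comm; rewrite adjC.
- by rewrite !rev_cat -!catA; apply: peq_braid.
- exact: peq_refl.
- exact: peq_trans uv vw.
Qed.

(** * Common left multiples of letters *)

(** [lcm_factor r s ++ [:: r]] and [lcm_factor s r ++ [:: s]] are two spellings
    of the least common left multiple of the letters [r] and [s]. *)
Definition lcm_factor (r s : nat) : word :=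
  if r == s then [::] else if adj r s then [:: r; s] else [:: s].

Lemma lcm_factorrr r : lcm_factor r r = [::].
Proof. by rewrite /lcm_factor eqxx. Qed.

Lemma lcm_factor_adj r s : adj r s -> lcm_factor r s = [:: r; s].
Proof. by rewrite /lcm_factor; case: eqP => [->|_ ->//]; rewrite adj_irr. Qed.

Lemma lcm_factor_far r s : r != s -> ~~ adj r s -> lcm_factor r s = [:: s].
Proof. by rewrite /lcm_factor => /negPf -> /negPf ->. Qed.

Lemma peq_swap i j x y : ~~ adj i j -> x ++ i :: j :: y ==+ x ++ j :: i :: y.
Proof. exact: peq_comm. Qed.

Lemma peq_flip i j x y :
  adj i j -> x ++ i :: j :: i :: y ==+ x ++ j :: i :: j :: y.
Proof. exact: peq_braid. Qed.

(** [X r] and [Y s] are, in a common way, multiples of the least common left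
    multiple of the letters [r] and [s]. *)
Definition last_letters_spec (X : word) (r : nat) (Y : word) (s : nat) : Prop :=
  exists c, X ==+ c ++ lcm_factor r s /\ Y ==+ c ++ lcm_factor s r.

Lemma last_letters_sym X r Y s :
  last_letters_spec X r Y s -> last_letters_spec Y s X r.
Proof. by case=> c [? ?]; exists c. Qed.

Lemma cat_pair (c : word) a b : c ++ [:: a; b] = (c ++ [:: a]) ++ [:: b].
Proof. by rewrite -catA. Qed.

Section ShortWords.
Variable (N : nat).
Hypothesis IH : forall (X : word) r (Y : word) s, size X < N ->
  X ++ [:: r] ==+ Y ++ [:: s] -> last_letters_spec X r Y s.

Lemma short_cancel (X Y : word) (r : nat) : size X < N ->
  X ++ [:: r] ==+ Y ++ [:: r] -> X ==+ Y.
Proof.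
by move=> sX /(IH sX) [c []]; rewrite lcm_factorrr => Xc Yc; rewrite Xc Yc.
Qed.

Lemma short_far (X Y : word) (r s : nat) : size X < N -> r != s -> ~~ adj r s ->
  X ++ [:: r] ==+ Y ++ [:: s] ->
    exists c, X ==+ c ++ [:: s] /\ Y ==+ c ++ [:: r].
Proof.
move=> sX rs far /(IH sX) [c []];
  rewrite !lcm_factor_far // 1?eq_sym // 1?adjC //.
by move=> ? ?; exists c.
Qed.

Lemma short_adj (X Y : word) (r s : nat) : size X < N -> adj r s ->
  X ++ [:: r] ==+ Y ++ [:: s] ->
  exists c, X ==+ c ++ [:: r; s] /\ Y ==+ c ++ [:: s; r].
Proof.
move=> sX near /(IH sX) [c []]; rewrite !lcm_factor_adj // 1?adjC //.
by move=> ? ?; exists c.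
Qed.

Lemma lcm_factor_comm t r s : ~~ adj t r -> ~~ adj t s ->
  lcm_factor r s ++ [:: t] ==+ t :: lcm_factor r s.
Proof.
rewrite !(adjC t) => rt st; rewrite /lcm_factor; case: eqP => // _.
case: ifP => _; last exact: (peq_swap [::] [::] st).
transitivity [:: r; t; s]; first exact: (peq_swap [:: r] [::] st).
exact: (peq_swap [::] [:: s] rt).
Qed.

(** In the next three lemmas a word ending in [r] has been compared with one
    ending in [t], and that one with a word ending in [s]; [c] and [d] are the
    two quotients. The hypothesis on shorter words, applied to [c] and [d],
    shows that both words divide off the least common left multiple of [r], [s]
    and [t], below which the conclusion is a computation. Here [r] commutes
    with [t] and [s]. *)
Lemma last_letters_far_near (c d : word) (r t s : nat) (X Y : word) :
  size X = N ->
  r != t -> r != s -> ~~ adj r t -> adj t s -> ~~ adj r s ->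
  X ==+ c ++ [:: t] -> c ++ [:: r] ==+ d ++ [:: t; s] -> Y ==+ d ++ [:: s; t] ->
  last_letters_spec X r Y s.
Proof.
move=> sX rt rs rtF tsA rsF Xc cd Yd.
have sc: size c < N by rewrite -sX (peq_size Xc) size_cat addn1.
rewrite cat_pair in cd; have [e [ce de]] := short_far sc rs rsF cd.
have sd: size d < N.
  by have := peq_size de; have := peq_size cd; rewrite !size_cat /=; lia.
have [||f [df ef]] := short_far sd _ _ de; rewrite // 1?eq_sym // 1?adjC //.
exists (f ++ [:: s; t]); rewrite !lcm_factor_far // 1?eq_sym // 1?adjC //;
  split.
  by rewrite Xc ce ef -!catA; apply: peq_flip.
rewrite Yd df -!catA; apply: peq_cat2l.
transitivity [:: s; r; t]; first exact: (peq_swap [::] [:: t] rsF).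
exact: (peq_swap [:: s] [::] rtF).
Qed.

(** The three letters form the chain [t - r - s]. *)
Lemma last_letters_near_far (c d : word) (r t s : nat) (X Y : word) :
  size X = N ->
  s != t -> adj r t -> ~~ adj t s -> adj r s ->
  X ==+ c ++ [:: r; t] -> c ++ [:: t; r] ==+ d ++ [:: s] -> Y ==+ d ++ [:: t] ->
  last_letters_spec X r Y s.
Proof.
move=> sX st rtA tsF rsA Xc cd Yd.
have sc: size c + 2 = N by rewrite -sX (peq_size Xc) size_cat.
rewrite cat_pair in cd.
have [|e [ce de]] := short_adj _ rsA cd; first by rewrite size_cat /=; lia.
rewrite cat_pair in ce.
have [||f [cf ef]] := short_far _ _ tsF ce; [lia|by rewrite eq_sym|].
have se: size e < N by have := peq_size ce; rewrite !size_cat /=; lia.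
have [g [eg fg]] := short_adj se rtA ef.
have stF: ~~ adj s t by rewrite adjC.
have srA: adj s r by rewrite adjC.
have trA: adj t r by rewrite adjC.
exists (g ++ [:: s; r; t]); rewrite !lcm_factor_adj // 1?adjC //; split.
  rewrite Xc cf fg -!catA; apply: peq_cat2l => /=.
  transitivity [:: t; s; r; s; t]; first exact: (peq_flip [:: t] [:: t] rsA).
  transitivity [:: s; t; r; s; t]; first exact: (peq_swap [::] _ tsF).
  transitivity [:: s; t; r; t; s];
    first exact: (peq_swap [:: s; t; r] [::] stF).
  exact: (peq_flip [:: s] [:: s] trA).
rewrite Yd de eg -!catA; apply: peq_cat2l => /=.
transitivity [:: r; s; t; r; t]; first exact: (peq_swap [:: r] _ tsF).
transitivity [:: r; s; r; t; r]; first exact: (peq_flip [:: r; s] [::] trA).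
transitivity [:: s; r; s; t; r]; first exact: (peq_flip [::] _ rsA).
exact: (peq_swap [:: s; r] [:: r] stF).
Qed.

(** The three letters form the chain [r - t - s]. *)
Lemma last_letters_near_near (c d : word) (r t s : nat) (X Y : word) :
  size X = N ->
  r != s -> adj r t -> adj t s -> ~~ adj r s ->
  X ==+ c ++ [:: r; t] -> c ++ [:: t; r] ==+ d ++ [:: t; s] ->
  Y ==+ d ++ [:: s; t] -> last_letters_spec X r Y s.
Proof.
move=> sX rs rtA tsA rsF Xc cd Yd.
have sc: size c + 2 = N by rewrite -sX (peq_size Xc) size_cat.
have sd: size d = size c by have := peq_size cd; rewrite !size_cat /=; lia.
rewrite !cat_pair in cd.
have [|e [ce de]] := short_far _ rs rsF cd; first by rewrite size_cat /=; lia.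
have [|f [cf ef]] := short_adj _ tsA ce; first lia.
have trA: adj t r by rewrite adjC.
have [|g [dg eg]] := short_adj _ trA de; first lia.
have fg : (f ++ [:: s]) ++ [:: t] ==+ (g ++ [:: r]) ++ [:: t].
  by rewrite -!catA -ef eg.
have {}fg := short_cancel _ fg.
have {}/fg fg : size (f ++ [:: s]) < N.
  by have := peq_size cf; rewrite !size_cat /=; lia.
have [|||h [fh gh]] := short_far _ _ _ fg; rewrite // 1?eq_sym // 1?adjC //.
  by have := peq_size cf; rewrite !size_cat /=; lia.
have srF: ~~ adj s r by rewrite adjC.
have stA: adj s t by rewrite adjC.
exists (h ++ [:: t; r; s; t]); rewrite !lcm_factor_far // 1?eq_sym //; split.
  rewrite Xc cf fh -!catA; apply: peq_cat2l => /=.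
  transitivity [:: r; t; r; s; t]; first exact: (peq_swap [:: r; t] _ srF).
  transitivity [:: t; r; t; s; t]; first exact: (peq_flip [::] _ rtA).
  exact: (peq_flip [:: t; r] [::] tsA).
rewrite Yd dg gh -!catA; apply: peq_cat2l => /=.
transitivity [:: s; t; s; r; t]; first exact: (peq_swap [:: s; t] _ rsF).
transitivity [:: t; s; t; r; t]; first exact: (peq_flip [::] _ stA).
transitivity [:: t; s; r; t; r]; first exact: (peq_flip [:: t; s] _ trA).
exact: (peq_swap [:: t] _ srF).
Qed.

(** The pairs of neighbours among [r], [t], [s] decide the case; three distinct
    integers are never pairwise neighbours, so the lemmas above, up to
    exchanging [r] and [s], and the case of a [t] commuting with both suffice.
    *)
Lemma last_letters_trans (X : word) (r : nat) z t Y s : size X = N ->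
  last_letters_spec X r z t -> last_letters_spec z t Y s ->
  last_letters_spec X r Y s.
Proof.
move=> sX [c [Xc zc]] [d [zd Yd]].
have [rt|rt] := eqVneq r t.
  exists d; rewrite rt lcm_factorrr cats0 in Xc zc *.
  by rewrite Xc -zc.
have [ts|ts] := eqVneq t s.
  exists c; rewrite -ts lcm_factorrr cats0 in zd Yd *.
  by rewrite Yd -zd.
have cd : c ++ lcm_factor t r ==+ d ++ lcm_factor t s by rewrite -zc.
have sc : size c + size (lcm_factor r t) =
  N by rewrite -sX (peq_size Xc) size_cat.
have tr : t != r by rewrite eq_sym.
have st : s != t by rewrite eq_sym.
have [rs|rs] := eqVneq r s.
  subst s; exists (c ++ lcm_factor r t); rewrite lcm_factorrr cats0.
  split=> //; rewrite Yd; apply: peq_cat2r; symmetry.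
  move: cd sc; case: (boolP (adj r t)) => rtA.
    rewrite !lcm_factor_adj // 1?adjC // !cat_pair => cd /= sc.
    apply: (@short_cancel _ _ t); first lia.
    by apply: short_cancel cd; rewrite size_cat /=; lia.
  rewrite !lcm_factor_far // 1?adjC // => cd /= sc.
  by apply: short_cancel cd; lia.
have sr : s != r by rewrite eq_sym.
move: Xc cd sc Yd.
case: (boolP (adj r t)) => rtA; case: (boolP (adj t s)) => tsA.
- rewrite !(@lcm_factor_adj r t, @lcm_factor_adj t r, @lcm_factor_adj t s,
  @lcm_factor_adj s t) // 1?adjC //.
  move=> Xc cd sc Yd.
  case: (boolP (adj r s)) => rsA; first by move: rsA rtA tsA rs rt ts;
    rewrite /adj; lia.
  exact: last_letters_near_near Xc cd Yd.
- rewrite !(@lcm_factor_adj r t, @lcm_factor_adj t r, @lcm_factor_far t s,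
  @lcm_factor_far s t) // 1?adjC //.
  move=> Xc cd sc Yd.
  case: (boolP (adj r s)) => rsA; first exact: last_letters_near_far Xc cd Yd.
  apply: last_letters_sym.
  apply: (last_letters_far_near (c:=d) (d:=c) (t:=t)) => //;
    try by [rewrite adjC|symmetry].
  by have := peq_size Yd; have := peq_size cd; have := peq_size Xc;
    rewrite !size_cat /=; lia.
- rewrite !(@lcm_factor_far r t, @lcm_factor_far t r, @lcm_factor_adj t s,
  @lcm_factor_adj s t) // 1?adjC //.
  move=> Xc cd sc Yd.
  case: (boolP (adj r s)) => rsA; last exact: last_letters_far_near Xc cd Yd.
  apply: last_letters_sym.
  apply: (last_letters_near_far (c:=d) (d:=c) (t:=t)) => //;
    try by [rewrite adjC|symmetry].
  by have := peq_size Yd; have := peq_size cd; have := peq_size Xc;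
    rewrite !size_cat /=; lia.
- rewrite !(@lcm_factor_far r t, @lcm_factor_far t r, @lcm_factor_far t s,
  @lcm_factor_far s t) // 1?adjC //.
  move=> Xc cd sc Yd.
  have [|e [ce de]] := IH _ cd; first by move: sc => /=; lia.
  exists (e ++ [:: t]); split.
    rewrite Xc ce -!catA; apply: peq_cat2l; apply: lcm_factor_comm => //.
    by rewrite adjC.
  rewrite Yd de -!catA; apply: peq_cat2l; apply: lcm_factor_comm => //.
  by rewrite adjC.
Qed.
End ShortWords.

(** Garside's key lemma, by induction on the length and, for a given length, on
    the derivation of the equivalence: a single relation at the end of a word
    is an instance of the conclusion, a relation elsewhere keeps the last
    letter, and compositions are handled by [last_letters_trans]. *)
Theorem peq_last_letters (X : word) r (Y : word) s :
  X ++ [:: r] ==+ Y ++ [:: s] -> last_letters_spec X r Y s.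
Proof.
move: {2}(size X) (erefl (size X)) => N; move: X r Y s.
have [M] := ubnP N; elim: M N => // M IHM N NM X r Y s sX XY.
have IH : forall (X : word) r (Y : word) s, size X < N ->
    X ++ [:: r] ==+ Y ++ [:: s] -> last_letters_spec X r Y s.
  by move=> X' r' Y' s' X'N; apply: (IHM (size X')) => //; lia.
have := cats1 X r; have := cats1 Y s; move: XY.
move: (X ++ [:: r]) (Y ++ [:: s]) => U V UV VY UX; clear IHM NM.
move: X r Y s sX VY UX; elim: UV => {U V}.
- move=> x y i j ij X r Y s sX; case/lastP: y => [|y t].
    rewrite !cats0 -!cat_rcons !cats0 => /rcons_inj [<- <-] /rcons_inj [<- <-].
    rewrite -!cats1.
    have [->|ne] := eqVneq i j; first by exists (x ++ [:: j]);
      rewrite lcm_factorrr cats0.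
    exists x; rewrite !lcm_factor_far // 1?eq_sym // adjC //.
  rewrite -!rcons_cat => /rcons_inj [<- <-] /rcons_inj [<- <-].
  exists (x ++ [:: i; j] ++ y); rewrite lcm_factorrr cats0; split=> //.
  by apply: peq_comm; rewrite adjC.
- move=> x y i j ij X r Y s sX; case/lastP: y => [|y t].
    rewrite !cats0 -!cat_rcons !cats0 => /rcons_inj [<- <-] /rcons_inj [<- <-].
    rewrite -!cats1 -!cat_pair.
    by exists x; rewrite !lcm_factor_adj // adjC.
  rewrite -!rcons_cat => /rcons_inj [<- <-] /rcons_inj [<- <-].
  exists (x ++ [:: i; j; i] ++ y); rewrite lcm_factorrr cats0; split=> //.
  by apply: peq_braid; rewrite adjC.
- move=> U X r Y s _ -> /rcons_inj [-> ->].
  by exists X; rewrite lcm_factorrr cats0.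
- move=> U W V UW IHU WV IHV X r Y s sX Vs Ur.
  have := peq_size UW; rewrite Ur; case/lastP: W => [|z t] in UW IHU WV IHV *.
    by rewrite size_rcons.
  rewrite !size_rcons => -[sXz].
  apply: (last_letters_trans IH sX (IHU _ _ _ _ sX (erefl _) Ur)).
  by apply: IHV => //; rewrite -sXz.
Qed.

Lemma peq_cancel1r (X Y : word) r : X ++ [:: r] ==+ Y ++ [:: r] -> X ==+ Y.
Proof.
by case/peq_last_letters=> c []; rewrite lcm_factorrr => Xc Yc; rewrite Xc Yc.
Qed.

Lemma peq_cancelr (X Y z : word) : X ++ z ==+ Y ++ z -> X ==+ Y.
Proof.
elim/last_ind: z X Y => [|z r IHz] X Y; first by rewrite !cats0.
by rewrite -cats1 !catA => /peq_cancel1r /IHz.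
Qed.

Lemma peq_cancell (z X Y : word) : z ++ X ==+ z ++ Y -> X ==+ Y.
Proof.
move/peq_rev; rewrite !rev_cat => /peq_cancelr /peq_rev.
by rewrite !revK.
Qed.

(** * Right divisors and wedges *)

Definition rdvd (g b : word) : Prop := exists x, b ==+ x ++ g.

(** Least common left multiples with one letter, constructed below a given
    common multiple [b] by peeling [g] from the right. The multiplier [t] uses
    only letters of [S], which is what keeps wedges inside the submonoid. *)
Lemma lcm_letter (S : pred nat) (b g : word) s :
  S s -> all S g -> rdvd g b -> rdvd [:: s] b ->
  exists t h, [/\ all S t, rdvd (t ++ g) b & t ++ g ==+ h ++ [:: s]].
Proof.
have [N] := ubnP (size b); elim: N b g s => // N IH b g s bN Ss Sg.
case/lastP: g => [|g r] in Sg *.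
  by move=> _ [x bx]; exists [:: s], [::]; split; rewrite //= ?Ss //; exists x.
move: Sg; rewrite all_rcons => /andP [Sr Sg].
case=> b1 b1E [b2 b2E].
rewrite -cats1 catA in b1E.
have b12 : (b1 ++ g) ++ [:: r] ==+ b2 ++ [:: s] by rewrite -b1E.
have sb : size b = (size (b1 ++ g)).+1 by rewrite (peq_size b1E) size_cat addn1.
case/peq_last_letters: b12 => c [gc b2c].
have [rs|rs] := eqVneq r s.
  exists [::], g; rewrite rs -cats1; split=> //.
  by exists b1; rewrite b1E rs -catA.
case: (boolP (adj r s)) => rsA; last first.
  rewrite !lcm_factor_far // 1?eq_sym // 1?adjC // in gc b2c.
  have [|||t [h [St [k kE] th]]] := IH (b1 ++ g) g s _ Ss Sg; first lia.
  - by exists b1.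
  - by exists c.
  exists t, (h ++ [:: r]); rewrite -cats1 !catA; split=> //.
    by exists k; rewrite b1E kE -!catA.
  rewrite th -!catA; apply: peq_cat2l.
  by apply: (peq_swap [::] [::]); rewrite adjC.
(* [b] is a multiple of [r s r]: first [s] is joined to [g], then [r] to the
   cofactor [h] of [s]. *)
have sr : adj s r by rewrite adjC.
rewrite !lcm_factor_adj // in gc b2c.
have [|||t [h [St [k kE] th]]] := IH (b1 ++ g) g s _ Ss Sg; first lia.
- by exists b1.
- by exists (c ++ [:: r]); rewrite gc cat_pair.
have kh : k ++ h ==+ c ++ [:: r].
  by apply: (@peq_cancel1r _ _ s); rewrite -catA -th -kE gc cat_pair.
have Sh : all S h.
  have : all S (t ++ g) by rewrite all_cat St.
  by rewrite (peq_all S th) all_cat => /andP [].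
have [|||t2 [h2 [St2 [k2 k2E] th2]]] := IH (k ++ h) h r _ Sr Sh.
- by have := peq_size kh; have := peq_size gc; move: sb bN;
  rewrite !size_cat /=; lia.
- by exists k.
- by exists c.
exists (t2 ++ t), (h2 ++ [:: s; r]); split.
- by rewrite all_cat St St2.
- exists k2; rewrite b1E kE th -cats1 !catA -(catA k2) -(catA k2) -(catA t2) th.
  by rewrite catA k2E -!catA.
rewrite -cats1 catA -(catA t2) th catA th2 -!catA; apply: peq_cat2l.
exact: (peq_flip [::] [::]).
Qed.

Definition wedge (S : pred nat) (b g : word) : Prop :=
  [/\ all S g, rdvd g b & forall h, all S h -> rdvd h b -> rdvd h g].

(** Letters of [S] are removed from the right as long as one divides. The
    choice of the letter does not matter, because any other divisor has a
    common left multiple with it that still divides [b] ([lcm_letter]). *)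
Theorem wedge_exists S b : exists g, wedge S b g.
Proof.
have [N] := ubnP (size b); elim: N b => // N IH b bN.
have [[s [Ss [b' bE]]]|none] := pselect (exists s, S s /\ rdvd [:: s] b);
  last first.
  exists [::]; split=> //; first by exists b; rewrite cats0.
  move=> h; case/lastP: h => [|h s]; first by exists [::].
  rewrite all_rcons => /andP [Ss _] [x bx]; case: none; exists s; split=> //.
  by exists (x ++ h); rewrite bx -cats1 catA.
have [|g [Sg [x b'x] gmax]] := IH b'.
  by have := peq_size bE; rewrite size_cat /=; lia.
exists (g ++ [:: s]); split.
- by rewrite all_cat Sg /= Ss.
- by exists x; rewrite bE b'x catA.
move=> h Sh hb; have [|t [h2 [St [k kE] th]]] := lcm_letter Ss Sh hb.
  by exists b'.
have [||q gq] := gmax h2.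
- have : all S (t ++ h) by rewrite all_cat St.
  by rewrite (peq_all S th) all_cat => /andP [].
- by exists k; apply: (@peq_cancel1r _ _ s); rewrite -bE kE th catA.
by exists (q ++ t); rewrite gq -!catA th.
Qed.

(** * The positive monoid embeds in the braid group *)

Lemma peq_comm_word i (w : word) :
  all (fun j => ~~ adj i j) w -> w ++ [:: i] ==+ i :: w.
Proof.
elim: w => //= j w IHw /andP [ij /IHw wi].
rewrite -cat1s wi; apply: (peq_swap [::]); by rewrite adjC.
Qed.

Definition delta (n : nat) : word := iota 1 n.-1.

Definition wpow (w : word) (k : nat) : word := flatten (nseq k w).

Lemma wpowS w k : wpow w k.+1 = w ++ wpow w k.
Proof. by []. Qed.

Lemma wpow1 w : wpow w 1 = w.
Proof. exact: cats0. Qed.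

Lemma wpowD w a b : wpow w (a + b) = wpow w a ++ wpow w b.
Proof. by rewrite /wpow nseqD flatten_cat. Qed.

(** Conjugation by [delta] moves every letter but the last one to its
    successor. *)
Lemma delta_letter n i : 0 < i -> i.+1 < n ->
  delta n ++ [:: i] ==+ i.+1 :: delta n.
Proof.
move=> i0 i_n.
have -> : delta n = iota 1 i.-1 ++ [:: i; i.+1] ++ iota i.+2 (n - i.+2).
  have -> : [:: i; i.+1] = iota i 2 by [].
  rewrite /delta -[X in iota X 2](_ : 1 + i.-1 = i); last lia.
  rewrite -[i.+2](_ : 1 + i.-1 + 2 = i.+2); last lia.
  by rewrite -!iotaD; congr iota; lia.
rewrite -!catA (@peq_comm_word i (iota i.+2 _)); last first.
  by apply/allP=> j; rewrite mem_iota /adj; lia.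
rewrite catA.
have : all (fun j => ~~ adj i.+1 j) (iota 1 i.-1).
  by apply/allP=> j; rewrite mem_iota /adj; lia.
move/peq_comm_word => com.
rewrite -[X in _ ==+ X]cat1s -[X in _ ==+ X]/((i.+1 :: iota 1 i.-1) ++ _) -com.
rewrite -!catA; apply: (peq_flip (iota 1 i.-1)).
by rewrite /adj eqxx.
Qed.

Lemma delta_word n (w : word) : all (letters 1 n.-2) w ->
  delta n ++ w ==+ map S w ++ delta n.
Proof.
elim: w => [|i w IHw] /=; first by rewrite cats0.
move=> /andP [iL /IHw wE]; rewrite -cat1s catA delta_letter;
  [|by move: iL; rewrite /letters; lia..].
by rewrite /= wE.
Qed.

Lemma delta_pow_letter n k i : 0 < i -> i + k < n ->
  wpow (delta n) k ++ [:: i] ==+ (i + k) :: wpow (delta n) k.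
Proof.
move=> i0; elim: k => [|k IHk] ik; first by rewrite addn0.
rewrite wpowS -catA IHk; last lia.
rewrite -cat1s catA delta_letter; [|lia..].
by rewrite addnS.
Qed.

Lemma delta_head n : 2 <= n -> delta n = 1 :: iota 2 (n - 2).
Proof. by case: n => [|[|n]] // _; rewrite subSS subSS subn0. Qed.

(** The last letter is brought back to the first one by two turns, so that the
    n-th power of [delta] fixes all letters. *)
Lemma delta_pow2_letter n : 2 <= n ->
  wpow (delta n) 2 ++ [:: n.-1] ==+ 1 :: wpow (delta n) 2.
Proof.
move=> n2; rewrite wpowS wpow1.
have dE : delta n = iota 1 (n - 2) ++ [:: n.-1].
  rewrite /delta -[[:: n.-1]]/(iota n.-1 1) [in iota n.-1 1](_ :
    n.-1 = 1 + (n - 2)).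
    by rewrite -iotaD; congr iota; lia.
  lia.
rewrite [in X in _ ==+ 1 :: (_ ++ X)]dE catA.
rewrite (@delta_word n (iota 1 (n - 2))); last first.
  by apply/allP=> j; rewrite mem_iota /letters; lia.
by rewrite -[map S _]/(map (addn 1) _) -iotaDl addn1 -cat_cons -cat_cons
  -delta_head.
Qed.

(** The full twist, a central braid that every letter divides. *)
Definition twist (n : nat) : word := wpow (delta n) n.

Lemma twist_letter n i : 0 < i < n -> twist n ++ [:: i] ==+ i :: twist n.
Proof.
move=> iL.
have -> : twist n = wpow (delta n) i.-1 ++ wpow (delta n) 2 ++
                    wpow (delta n) (n.-1 - i).
  by rewrite -!wpowD; congr wpow; lia.
have := @delta_pow_letter n i.-1 1; rewrite add1n prednK; last lia.
have := @delta_pow2_letter n.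
have := @delta_pow_letter n (n.-1 - i) i; rewrite subnKC; last lia.
move: (wpow _ i.-1) (wpow _ 2) (wpow _ (_ - _)) => x y z zi yn x1.
rewrite -!catA zi; [|lia..].
rewrite -cat1s (catA y) yn; last lia.
by rewrite -(cat1s 1) -!catA (catA x) x1; [|lia..].
Qed.

Lemma twist_word n (w : word) : all (letters 1 n.-1) w ->
  twist n ++ w ==+ w ++ twist n.
Proof.
elim: w => [|i w IHw] /=; first by rewrite cats0.
move=> /andP [iL /IHw wE]; rewrite -cat1s catA twist_letter.
  by rewrite cat_cons wE.
by move: iL; rewrite /letters; lia.
Qed.

Definition cofactor (n i : nat) : word :=
  wpow (delta n) i.-1 ++ iota 2 (n - 2) ++ wpow (delta n) (n - i).

Lemma letter_cofactor n i : 0 < i < n -> i :: cofactor n i ==+ twist n.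
Proof.
move=> iL; rewrite /cofactor -cat1s catA.
have iE := @delta_pow_letter n i.-1 1.
rewrite add1n prednK in iE; last lia.
rewrite -[[:: i] ++ _]/(i :: _) -iE; [|lia..].
rewrite -catA (catA [:: 1]) cat1s -delta_head; last lia.
rewrite -{2}(wpow1 (delta n)) -!wpowD.
by rewrite /twist (_ : i.-1 + (1 + (n - i)) = n) //; lia.
Qed.

Lemma cofactor_positive n i : 0 < i < n -> all (letters 1 n.-1) (cofactor n i).
Proof.
move=> iL; have /(peq_all (letters 1 n.-1)) /= := letter_cofactor iL.
rewrite /twist /wpow.
have -> : all (letters 1 n.-1) (flatten (nseq n (delta n))).
  apply/allP=> j /flattenP [w]; rewrite mem_nseq => /andP [_ /eqP ->].
  by rewrite mem_iota /letters; lia.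
by move=> /andP [].
Qed.

Lemma cofactor_letter n i : 0 < i < n -> cofactor n i ++ [:: i] ==+ twist n.
Proof.
move=> iL; apply: (@peq_cancell [:: i]).
by rewrite catA cat1s letter_cofactor // twist_letter.
Qed.

Definition positive_part n (w : signed_word n) : word :=
  flatten [seq if x.2 then [:: val x.1] else cofactor n (val x.1) | x <- w].

Definition negative_count n (w : signed_word n) : nat :=
  count (fun x => ~~ x.2) w.

Lemma positive_part_cat n (u v : signed_word n) :
  positive_part (u ++ v) = positive_part u ++ positive_part v.
Proof. by rewrite /positive_part map_cat flatten_cat. Qed.

Lemma positive_part_positive n (w : signed_word n) :
  all (letters 1 n.-1) (positive_part w).
Proof.
elim: w => // -[i e] w; rewrite -cat1s positive_part_cat all_cat => ->.
rewrite andbT /positive_part /= cats0; have := valP i.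
case: e => /= iL; last exact: cofactor_positive.
by rewrite /letters; lia.
Qed.

(** An inverse letter is its cofactor divided by the twist, so a signed word is
    a fraction whose denominator is a power of the twist. The equation is the
    equality of two such fractions, and cancellation makes it transitive. *)
Lemma artin_equiv_positive_part n (u v : signed_word n) : artin_equiv u v ->
  positive_part u ++ wpow (twist n) (negative_count v) ==+
  positive_part v ++ wpow (twist n) (negative_count u).
Proof.
elim=> {u v} [x u v y uv|u//|u v _ uv|u v w _ uv _ vw].
- rewrite !positive_part_cat /negative_count !count_cat -!catA.
  apply: peq_cat2l.
  set k := count _ x; set l := count _ y.
  case: uv => [i e|i j ij|i j ij].
  + have iL := valP i.
    have -> : positive_part [:: (i, e); (i, ~~ e)] ==+ twist n.
      rewrite /positive_part /= cats0; case: e => /=.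
        exact: letter_cofactor.
      exact: cofactor_letter.
    have -> : count (fun x => ~~ x.2) [:: (i, e); (i, ~~ e)] = 1 by case: e.
    rewrite add0n addnCA add1n wpowS /= !catA; apply: peq_cat2r.
    by rewrite twist_word // positive_part_positive.
  + rewrite /positive_part /= !add0n; apply: (peq_swap [::]).
    exact: adj_far.
  + rewrite /positive_part /= !add0n; apply: (peq_flip [::]).
    exact: adj_next.
- by symmetry.
- apply: (@peq_cancelr _ _ (wpow (twist n) (negative_count v))).
  rewrite -!catA -!wpowD (addnC (negative_count w)) wpowD catA uv.
  rewrite -!catA -!wpowD addnC wpowD catA vw -!catA -!wpowD.
  by rewrite addnC.
Qed.

Definition signed_of n (w : word) : signed_word n :=
  [seq (i, true) | i <- pmap insub w].

Lemma word_braidE n (w : word) : word_braid n w = signed_braid (signed_of n w).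
Proof.
elim: w => [|r w IHw]; first by rewrite /word_braid big_nil.
rewrite /word_braid big_cons -/(word_braid n w) IHw /sigma /signed_of /=.
by case: insub => [i|] /=; rewrite ?mul1g // [LHS]signed_braidM.
Qed.

Lemma positive_part_signed_of n (w : word) : all (letters 1 n.-1) w ->
  positive_part (signed_of n w) = w.
Proof.
elim: w => //= r w IHw /andP [rL /IHw wE].
have rn : 0 < r < n by move: rL; rewrite /letters; lia.
by rewrite /signed_of /= insubT /= -[RHS]cat1s -[X in _ ++ X]wE.
Qed.

Lemma negative_count_signed_of n (w : word) :
  negative_count (signed_of n w) = 0.
Proof. by rewrite /signed_of /negative_count count_map; elim: (pmap _ _). Qed.

Theorem word_braid_inj n (u v : word) :
  all (letters 1 n.-1) u -> all (letters 1 n.-1) v ->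
  word_braid n u = word_braid n v -> u ==+ v.
Proof.
move=> uL vL; rewrite !word_braidE => /signed_braidP /artin_equiv_positive_part.
by rewrite !negative_count_signed_of !cats0 !positive_part_signed_of.
Qed.

Lemma word_braid_cat n (u v : word) :
  word_braid n (u ++ v) = (word_braid n u * word_braid n v)%g.
Proof. exact: big_cat. Qed.

Lemma peq_word_braid n (u v : word) : all (letters 1 n.-1) u ->
  u ==+ v -> word_braid n u = word_braid n v.
Proof.
move=> uL uv; elim: uv uL => {u v}
  [x y i j ij|x y i j ij|//|u v w uv IHu vw IHv uL].
- rewrite !all_cat /= => /andP [_ /andP [/and3P [iL jL _] _]].
  suff E : word_braid n [:: i; j] = word_braid n [:: j; i].
    by rewrite !(word_braid_cat _ x) (word_braid_cat _ [:: i;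
      j] y) E -word_braid_cat.
  rewrite !word_braidE.
  have in_ : 0 < i < n by move: iL; rewrite /letters; lia.
  have jn : 0 < j < n by move: jL; rewrite /letters; lia.
  rewrite /signed_of /= !insubT /=; apply/signed_braidP.
  wlog lt_ij : i j in_ jn ij {iL jL} / i <= j.
    move=> th; case: (leqP i j) => [|/ltnW] le; first exact: th.
    by apply/artin_sym/th => //; rewrite adjC.
  move: lt_ij ij; rewrite leq_eqVlt => /orP [/eqP e|lt_ij ij].
    by subst j; rewrite (bool_irrelevance jn in_); constructor.
  apply: (artin_step [::] [::] (@artin_far n (Sub i in_) (Sub j jn) _)) => /=.
  by move: lt_ij ij; rewrite /adj; lia.
- rewrite !all_cat /= => /andP [_ /andP [/and4P [iL jL _ _] _]].
  suff E : word_braid n [:: i; j; i] = word_braid n [:: j; i; j].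
    by rewrite !(word_braid_cat _ x) (word_braid_cat _ [:: i; j;
      i] y) E -word_braid_cat.
  rewrite !word_braidE.
  have in_ : 0 < i < n by move: iL; rewrite /letters; lia.
  have jn : 0 < j < n by move: jL; rewrite /letters; lia.
  rewrite /signed_of /= !insubT /=; apply/signed_braidP.
  wlog lt_ij : i j in_ jn ij {iL jL} / i <= j.
    move=> th; case: (leqP i j) => [|/ltnW] le; first exact: th.
    by apply/artin_sym/th => //; rewrite adjC.
  apply: (artin_step [::] [::] (@artin_near n (Sub i in_) (Sub j jn) _)) => /=.
  by move: lt_ij ij; rewrite /adj; lia.
- by rewrite (IHu uL) IHv // -(peq_all _ uv).
Qed.

(** * Greedy factorizations and relabellings *)

#[local] Instance rdvd_peq : Proper (peq ==> peq ==> iff) rdvd.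
Proof.
move=> g g' gg' b b' bb'; split=> -[x bx]; exists x.
  by rewrite -bb' -gg'.
by rewrite bb' gg'.
Qed.

Lemma rdvd_catl x g : rdvd g (x ++ g).
Proof. by exists x. Qed.

Lemma rdvd_trans g h b : rdvd g h -> rdvd h b -> rdvd g b.
Proof. by case=> x hx [y bY]; exists (y ++ x); rewrite bY hx catA. Qed.

Lemma rdvd_all (S : pred nat) g b x : all S b -> b ==+ x ++ g -> all S x.
Proof. by move=> Sb /(peq_all S); rewrite Sb all_cat => /esym /andP []. Qed.

Lemma rdvd_anti g h : rdvd g h -> rdvd h g -> g ==+ h.
Proof.
case=> x hx [y gy]; have := peq_size hx; have := peq_size gy; rewrite !size_cat.
case: x hx => [|i x] hx /=; last lia.
by move=> *; rewrite hx.
Qed.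

Lemma wedge_peq S b b' g g' : all S g' -> b ==+ b' -> g ==+ g' ->
  wedge S b g -> wedge S b' g'.
Proof.
move=> Sg' bb' gg' [Sg gb gmax]; split=> //; first by rewrite -bb' -gg'.
by move=> h Sh; rewrite -bb' -gg'; apply: gmax.
Qed.

Lemma wedge_unique S b g g' : wedge S b g -> wedge S b g' -> g ==+ g'.
Proof.
by move=> [Sg gb gmax] [Sg' gb' gmax']; apply: rdvd_anti;
  [apply: gmax'|apply: gmax].
Qed.

Lemma wedge_nil S : wedge S [::] [::].
Proof. by split=> //; exists [::]. Qed.

(** The head of the list is the rightmost factor, since slots and alternate
    factors are numbered from the right. *)
Definition tower_word (us : seq word) : word := flatten (rev us).

Lemma tower_word_cons u us : tower_word (u :: us) = tower_word us ++ u.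
Proof. by rewrite /tower_word rev_cons -cats1 flatten_cat /= cats0. Qed.

Lemma tower_word_cat us vs :
  tower_word (us ++ vs) = tower_word vs ++ tower_word us.
Proof. by rewrite /tower_word rev_cat flatten_cat. Qed.

Lemma tower_word_nseq k : tower_word (nseq k [::]) = [::].
Proof. by elim: k => //= k IHk; rewrite tower_word_cons IHk. Qed.

Lemma tower_word_drop k us :
  tower_word (drop k us) = tower_word (drop k.+1 us) ++ nth [::] us k.
Proof.
case: (ltnP k (size us)) => kus;
  first by rewrite (drop_nth [::] kus) tower_word_cons.
by rewrite !drop_oversize ?nth_default //; lia.
Qed.

Lemma tower_word_all S us :
  (forall k, all S (nth [::] us k)) -> all S (tower_word us).
Proof.
elim: us => // u us IHus Sus; rewrite tower_word_cons all_cat (Sus 0) andbT.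
by apply: IHus => k; apply: (Sus k.+1).
Qed.

Lemma tower_word_pad us N : size us <= N ->
  tower_word (mkseq (nth [::] us) N) = tower_word us.
Proof.
move=> usN.
have -> : mkseq (nth [::] us) N = us ++ nseq (N - size us) [::].
  apply: (@eq_from_nth _ [::]);
    rewrite size_mkseq ?size_cat ?size_nseq ?subnKC //.
  by move=> i iN; rewrite nth_mkseq // nth_cat nth_nseq; case: ltnP => // ?;
    rewrite nth_default ?if_same.
by rewrite tower_word_cat tower_word_nseq.
Qed.

Lemma tower_word_mkseq U a b : tower_word (mkseq U (a + b)) =
  flatten [seq U (i + a) | i <- rev (iota 0 b)] ++
  flatten [seq U (a - j) | j <- iota 1 a].
Proof.
rewrite /tower_word /mkseq iotaD map_cat rev_cat flatten_cat;
  congr (flatten _ ++ flatten _).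
  rewrite -map_rev add0n -{1}[a]addn0 iotaDl -map_rev -map_comp.
  by apply: eq_map => i /=; rewrite addnC.
apply: (@eq_from_nth _ [::]); first by rewrite size_rev !size_map !size_iota.
move=> i; rewrite size_rev size_map size_iota => ia.
rewrite nth_rev size_map ?size_iota // !(nth_map 0) ?size_iota ?nth_iota //;
  try lia.
Qed.

Lemma tower_word_eq_prefix us vs k :
  (forall l, l < k -> nth [::] us l ==+ nth [::] vs l) ->
  tower_word us ==+ tower_word vs ->
  tower_word (drop k us) ==+ tower_word (drop k vs).
Proof.
elim: k => [|k IHk] eqk eqw; first by rewrite !drop0.
have /IHk -/(_ eqw) : forall l, l < k -> nth [::] us l ==+ nth [::] vs l.
  by move=> l lk; apply: eqk; lia.
rewrite tower_word_drop [X in _ ==+ X]tower_word_drop (eqk k) //.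
exact: peq_cancelr.
Qed.

Definition greedy (S : nat -> pred nat) (us : seq word) : Prop :=
  forall k, wedge (S k) (tower_word (drop k us)) (nth [::] us k).

Lemma greedy_unique S us vs : greedy S us -> greedy S vs ->
  tower_word us ==+ tower_word vs -> forall k, nth [::] us k ==+ nth [::] vs k.
Proof.
move=> gu gv eqw; elim/ltn_ind => k IHk.
apply: wedge_unique (gu k) _.
apply: wedge_peq (gv k) => //; first by case: (gv k).
by symmetry; apply: tower_word_eq_prefix.
Qed.

Lemma greedy_cons S b u x us :
  wedge (S 0) b u -> b ==+ x ++ u -> x ==+ tower_word us ->
  greedy (fun k => S k.+1) us ->
  b ==+ tower_word (u :: us) /\ greedy S (u :: us).
Proof.
move=> ub bx xus gus; have bE : b ==+ tower_word (u :: us).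
  by rewrite tower_word_cons -xus.
split=> // -[|k]; last exact: gus.
by have [Su _ _] := ub; apply: wedge_peq ub.
Qed.

(** Every letter is allowed again and again, so the last letter of a nontrivial
    remainder is eventually divided off and the remainder gets shorter. *)
Lemma greedy_exists (P : pred nat) (S : nat -> pred nat) b :
  (forall k r, P r -> exists j, S (k + j) r) -> all P b ->
  exists us, b ==+ tower_word us /\ greedy S us.
Proof.
have [N] := ubnP (size b); elim: N b S => // N IHN b S bN cov Pb.
case/lastP: b => [|b r] in bN Pb *.
  by exists [::]; split=> // k; rewrite nth_nil; apply: wedge_nil.
have Pr : P r by move: Pb; rewrite all_rcons => /andP [].
have [j] := cov 0 r Pr; rewrite add0n => Sjr.
elim: j S cov Sjr => [|j IHj] S cov Sjr;
  have [u ub] := wedge_exists (S 0) (rcons b r); case: (ub) => Su [x bx] umax;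
  (have covS k r' : P r' -> exists j, S (k + j).+1 r'
    by (move=> Pr'; have [i ?] := cov k.+1 r' Pr'; exists i; rewrite -addSn));
  have Px := rdvd_all Pb bx; have sz := peq_size bx; rewrite size_cat in sz.
- have u0 : 0 < size u.
    have [||y uy] := umax [:: r]; first by rewrite /= Sjr.
      by exists b; rewrite cats1.
    by have := peq_size uy; rewrite size_cat /=; lia.
  have [|us [xus gus]] := IHN x (fun k => S k.+1) _ covS Px; first lia.
  by exists (u :: us); apply: greedy_cons ub bx xus gus.
- have [us [xus gus]] : exists us, x ==+ tower_word us /\
  greedy (fun k => S k.+1) us.
    case: u => [|i u] in ub Su bx umax sz *.
      have [us [bus gus]] := IHj (fun k => S k.+1) covS Sjr.
      by exists us; split=> //; rewrite -bus bx cats0.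
    by apply: (IHN x (fun k => S k.+1) _ covS Px); move: sz => /=; lia.
  by exists (u :: us); apply: greedy_cons ub bx xus gus.
Qed.

(** [f] identifies the submonoid generated by [S] with the positive braids on
    [N] strands: a bijection of the letters that respects neighbours. *)
Definition relabels (S : pred nat) (N : nat) (f : nat -> nat) : Prop :=
  exists g, [/\ forall r, S r -> letters 1 N.-1 (f r) /\ g (f r) = r,
    forall r, letters 1 N.-1 r -> S (g r) /\ f (g r) = r &
    forall r s, S r -> S s -> adj (f r) (f s) = adj r s].

Lemma peq_map (S : pred nat) f u v :
  (forall r s, S r -> S s -> adj (f r) (f s) = adj r s) ->
  all S u -> u ==+ v -> map f u ==+ map f v.
Proof.
move=> fadj Su uv; elim: uv Su => {u v}
  [x y i j ij|x y i j ij|//|u v w uv IHu vw IHv Su].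
- rewrite !all_cat !map_cat /= => /andP [_ /andP [/and3P [Si Sj _] _]].
  by apply: peq_swap; rewrite fadj.
- rewrite !all_cat !map_cat /= => /andP [_ /andP [/and4P [Si Sj _ _] _]].
  by apply: peq_flip; rewrite fadj.
- by rewrite (IHu Su) IHv // -(peq_all _ uv).
Qed.

Section Relabel.
Variables (S : pred nat) (N : nat) (f : nat -> nat).
Hypothesis fP : relabels S N f.

Lemma relabel_letters u : all S u -> all (letters 1 N.-1) (map f u).
Proof.
case: fP => g [fg _ _] Su; rewrite all_map; apply: sub_all Su => r Sr.
by case: (fg r Sr).
Qed.

Lemma relabel_inj u v : all S u -> all S v -> map f u = map f v -> u = v.
Proof.
case: fP => g [fg _ _] Su Sv /(congr1 (map g)).
have K w : all S w -> map g (map f w) = w.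
  by elim: w => //= r w IHw /andP [/fg [_ ->] /IHw ->].
by rewrite !K.
Qed.

Lemma relabel_surj w : all (letters 1 N.-1) w ->
  exists2 u, all S u & map f u = w.
Proof.
case: fP => g [_ gf _] Lw; exists (map g w).
  by rewrite all_map; apply: sub_all Lw => r /gf [].
by elim: w Lw => //= r w IHw /andP [/gf [_ ->] /IHw ->].
Qed.

Lemma relabel_peq u v : all S u -> u ==+ v -> map f u ==+ map f v.
Proof. by case: fP => g [_ _ fadj]; apply: peq_map. Qed.

Lemma relabel_peq_inj u v : all S u -> all S v -> map f u ==+ map f v ->
  u ==+ v.
Proof.
case: fP => g [fg gf fadj] Su Sv fuv.
have K w : all S w -> map g (map f w) = w.
  by elim: w => //= r w IHw /andP [/fg [_ ->] /IHw ->].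
rewrite -(K u Su) -(K v Sv); apply: (@peq_map (letters 1 N.-1)) fuv.
  move=> r s /gf [Sr rE] /gf [Ss sE]; by rewrite -fadj // rE sE.
exact: relabel_letters.
Qed.
End Relabel.

(** * Towers as slot sequences, and words of maximal code *)

(** Slot [k] is the entry of index [k - (n - 2)] of a code: the word X_(n-2-k)
    if this index is negative, and the word A_(k-(n-2)) otherwise. *)
Definition slot_letters (n k : nat) : pred nat :=
  if k < n - 2 then letters (n.-1 - k) n.-1 else alt_letters n (k - (n - 2)).

(** A slot that holds X_j has n - j = k + 2 strands, and one that holds A_i has
    n - 1; the two formulas agree from k = n - 3 on. *)
Definition slot_strands (n k : nat) : nat := minn k.+2 n.-1.

Definition slot_map (n k : nat) : nat -> nat :=
  if k < n - 2 then subn^~ (n - 2 - k) else alt_letter_id n (k - (n - 2)).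

Lemma iter_Sh j r : iter j Sh r = r - j.
Proof. by elim: j => [|j IHj]; rewrite ?subn0 // iterS IHj /Sh subnS. Qed.

Lemma iter_D n j r : r <= n -> iter j (D n) r = if odd j then n - r else r.
Proof.
move=> rn; elim: j => //= j ->; case: odd => //=; rewrite /D; lia.
Qed.

Lemma alt_letters_bound n i r : 2 < n -> alt_letters n i r -> 0 < r < n.
Proof. by rewrite /alt_letters; case: odd; rewrite /letters; lia. Qed.

Lemma tower_letter_alt n i r :
  2 < n -> alt_letters n i r -> tower_letter n i r = alt_letter_id n i r.
Proof.
move=> n2 /(alt_letters_bound n2) rn; case: i => //= i.
rewrite iter_D /alt_letter_id /=; last lia.
by case: odd.
Qed.

Lemma relabels_alt n i : 2 < n ->
  relabels (alt_letters n i) n.-1 (alt_letter_id n i).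
Proof.
move=> n2; rewrite /alt_letters /alt_letter_id; case: eqP => [->|i0] /=.
  exists S; split; rewrite /letters /Sh /adj; lia.
case: odd; first by exists id; split; rewrite /letters; lia.
by exists (subn n); split; rewrite /letters /D /adj; lia.
Qed.

Lemma relabels_slot n k : 2 < n ->
  relabels (slot_letters n k) (slot_strands n k) (slot_map n k).
Proof.
move=> n2; rewrite /slot_letters /slot_strands /slot_map; case: ifP => kn;
  last first.
  rewrite (_ : minn _ _ = n.-1); last lia.
  exact: relabels_alt.
exists (addn (n - 2 - k)); split; rewrite /letters /adj; lia.
Qed.

Lemma slot_strands_ge2 n k : 2 < n -> 2 <= slot_strands n k.
Proof. rewrite /slot_strands; lia. Qed.

Lemma slot_strands_lt n k : 2 < n -> slot_strands n k < n.
Proof. rewrite /slot_strands; lia. Qed.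

Lemma slot_letters_positive n k r : 2 < n -> slot_letters n k r ->
  letters 1 n.-1 r.
Proof.
move=> n2; rewrite /slot_letters; case: ifP => kn; first by rewrite /letters;
  lia.
by move=> /(alt_letters_bound n2); rewrite /letters; lia.
Qed.

Lemma slot_cover n k r : 2 < n -> letters 1 n.-1 r ->
  exists j, slot_letters n (k + j) r.
Proof.
move=> n2 rL.
(* The slot has to be of odd index for the letter 1, of even index otherwise. *)
exists (n - 2 + (odd (k + (r == 1)))).
rewrite /slot_letters ifF; last lia.
rewrite addnCA addnC addnK /alt_letters oddD.
case: eqP rL => [->|r1] /=; rewrite ?addn0 ?addn1 /=.
  by case: odd => /=; rewrite /letters; lia.
by case: odd => /=; rewrite /letters; lia.
Qed.

Definition tower (n : nat) (us : seq word) (C : nat -> code) : Prop :=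
  forall k, all (slot_letters n k) (nth [::] us k) /\
    has_code (slot_strands n k) (map (slot_map n k) (nth [::] us k)) (C k).

Lemma has_code2P W c : has_code 2 W c <->
  exists a, W = nseq a 1 /\ c = Code2 a.
Proof.
split=> [|[a [-> ->]]]; last exact: has_code2.
move E: 2 => n H; case: H E => [a _|n' m A X C n3 _ _ _ _ _ n2];
  first by exists a.
by rewrite -n2 in n3.
Qed.

(** The two kinds of words in a tower, and the different rules for their
    letters and strands, become one condition per slot; empty words pad the
    list. *)
Lemma has_codeP n W c : 2 < n -> has_code n W c <->
  exists us C, [/\ c = CodeSeq C, W = tower_word us & tower n us C].
Proof.
move=> n2; split.
  move=> H; case: H n2 => // {W c} {}n m A X C n2 SA SX cA c0 cX _.
  pose U k := if k < n - 2 then X (n - 2 - k) else A (k - (n - 2)).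
  exists (mkseq U (n - 2 + m.+1)), C; split=> //.
    rewrite tower_word_mkseq; congr (flatten _ ++ flatten _).
      by apply: eq_map => i; rewrite /U ifF ?addnK //; lia.
    apply/eq_in_map => j; rewrite mem_iota => jn; rewrite /U ifT; last lia.
    by congr X; lia.
  move=> k; case: (ltnP k (n - 2)) => kn.
    rewrite nth_mkseq; last lia.
    have j1 : 1 <= n - 2 - k <= n - 2 by lia.
    rewrite /U /slot_letters /slot_strands /slot_map kn; split.
      by have := SX _ j1; congr (is_true (all (letters _ _) _)); lia.
    have := cX _ j1; rewrite subKn; last lia.
    rewrite (_ : n - (n - 2 - k) = minn k.+2 n.-1); last lia.
    rewrite (_ : map _ _ = [seq r - (n - 2 - k) | r <- X (n - 2 - k)]) //.
    by apply: eq_map => r; rewrite iter_Sh.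
  have nE : slot_strands n k = n.-1 by rewrite /slot_strands; lia.
  have kE : C k = C (k - (n - 2) + (n - 2)) by rewrite subnK.
  case: (ltnP k (n - 2 + m.+1)) => km; last first.
    rewrite nth_default ?size_mkseq //; split=> //=.
    by rewrite nE kE; apply: c0; lia.
  have im : k - (n - 2) <= m by lia.
  rewrite nth_mkseq // nE kE /U /slot_letters /slot_map ltnNge kn /=; split.
    exact: SA.
  have := cA _ im; set V := map _ _; set V' := map _ _; suff -> : V = V' by [].
  apply/eq_in_map => r /(allP (SA _ im)) rA; exact: tower_letter_alt.
case=> us [C [-> -> tC]].
have /tower_word_pad <- : size us <= n - 2 + (size us).+1 by lia.
rewrite tower_word_mkseq.
have nE i : slot_strands n (i + (n - 2)) = n.-1 by rewrite /slot_strands; lia.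
have lE i : slot_letters n (i + (n - 2)) = alt_letters n i.
  by rewrite /slot_letters ltnNge leq_addl addnK.
apply: (has_codeS n2) => [i im|j jn|i im|i im|j jn].
- by have [] := tC (i + (n - 2)); rewrite lE.
- have [] := tC (n - 2 - j); rewrite /slot_letters ifT; last lia.
  by move=> ? _; rewrite (_ : j.+1 = n.-1 - (n - 2 - j)) //; lia.
- have [] := tC (i + (n - 2)); rewrite lE nE /slot_map ltnNge leq_addl addnK /=.
  move=> SA; set V := map _ _; set V' := map _ _; suff -> : V = V' by [].
  by apply/eq_in_map => r /(allP SA) rA; rewrite tower_letter_alt.
- by have [_] := tC (i + (n - 2)); rewrite nE nth_default //;
  exact: leq_trans (ltnW im) (leq_addr _ _).
- have [_] := tC (n - 2 - j); rewrite /slot_strands /slot_map ifT; last lia.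
  rewrite (_ : minn _ _ = n - j); last lia.
  rewrite (_ : n - 2 - (n - 2 - j) = j); last lia.
  set V := map _ _; set V' := map _ _; suff -> : V = V' by [].
  by apply: eq_map => r; rewrite iter_Sh.
Qed.

Lemma lt_right_neq c c' : lt_right c c' -> c <> c'.
Proof.
elim=> {c c'} [a b ab|C C' l _ _ IH]; first by case=> E; rewrite E ltnn in ab.
by case=> E; apply: IH; rewrite E.
Qed.

Lemma lt_right_trans c2 c1 c3 : lt_right c1 c2 -> lt_right c2 c3 ->
  lt_right c1 c3.
Proof.
move=> lt12; elim: lt12 c3 => {c1 c2} [a b ab|C1 C2 l eq12 lt12 IH] c3 lt23.
  by inversion_clear lt23; constructor; lia.
inversion lt23 as [|C C3 l' eq23 lt23' E1 E2]; subst C c3.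
have [ll'|l'l|E] := ltngtP l l'; last by subst l'; apply: (@lt_rightS _ _ l);
  [by move=> i il; rewrite eq12 // eq23|exact: IH].
- apply: (@lt_rightS _ _ l); last by rewrite -eq23.
  by move=> i il; rewrite eq12 // eq23 // (ltn_trans il).
- apply: (@lt_rightS _ _ l'); last by rewrite eq12.
  by move=> i il'; rewrite eq12 ?eq23 // (ltn_trans il').
Qed.

Lemma tower_word_ext us vs :
  (forall k, nth [::] us k = nth [::] vs k) -> tower_word us = tower_word vs.
Proof.
move=> uv; rewrite -(@tower_word_pad us _ (leq_maxl _ (size vs))).
by rewrite -(@tower_word_pad vs _ (leq_maxr (size us) _)); congr tower_word;
  apply: eq_mkseq.
Qed.

Lemma tower_word_peq us vs :
  (forall k, nth [::] us k ==+ nth [::] vs k) ->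
    tower_word us ==+ tower_word vs.
Proof.
elim: us vs => [|u us IH] vs uv.
  suff -> : tower_word vs = tower_word [::] by [].
  by apply: tower_word_ext => k;
    rewrite nth_nil (@peq_nil (nth _ _ k)) // -(uv k) nth_nil.
case: vs uv => [|v vs] uv.
  suff -> : tower_word (u :: us) = tower_word [::] by [].
  by apply: tower_word_ext => k;
    rewrite nth_nil (@peq_nil (nth _ _ k)) // (uv k) nth_nil.
have /= uv0 := uv 0; rewrite !tower_word_cons (IH vs) ?uv0 // => k;
  exact: (uv k.+1).
Qed.

(** The letters of a slot are recovered from its relabelled word, and the
    latter from its code by induction on the number of strands. *)
Lemma has_code_inj n W W' c : 2 <= n -> has_code n W c -> has_code n W' c ->
  W = W'.
Proof.
elim/ltn_ind: n W W' c => n IH W W' c; rewrite leq_eqVlt => /orP [/eqP <-|n2].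
  by move=> /has_code2P [a [-> ->]] /has_code2P [b [-> [->]]].
move=> /(has_codeP _ _ n2) [us [C [-> -> tC]]].
move=> /(has_codeP _ _ n2) [us' [_ [[<-] -> tC']]].
apply: tower_word_ext => k; have [Su cu] := tC k; have [Su' cu'] := tC' k.
apply: (relabel_inj (relabels_slot k n2)) => //.
by apply: IH cu cu'; rewrite ?slot_strands_lt ?slot_strands_ge2.
Qed.

Lemma tower_word_set_nth us k u : size us <= k ->
  tower_word (set_nth [::] us k u) = u ++ tower_word us.
Proof.
move=> usk; have -> : set_nth [::] us k u =
  us ++ nseq (k - size us) [::] ++ [:: u].
  apply: (@eq_from_nth _ [::]).
    by rewrite size_set_nth !size_cat size_nseq /=; lia.
  move=> i _; rewrite nth_set_nth /= !nth_cat size_nseq nth_nseq.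
  have [->|ik] := eqVneq i k; first by rewrite ltnNge usk /= ltnn subnn.
  case: ltnP => // ui; rewrite nth_default //; case: ifP => //.
    by rewrite if_same.
  by move=> h; rewrite nth_default //=; lia.
by rewrite !tower_word_cat tower_word_nseq cats0 tower_word_cons.
Qed.

(** The new letter is put in a slot to the left of all the words of the tower:
    the code of the empty word is replaced there by the code of a letter, which
    is larger by induction, and all weightier entries are unchanged. *)
Lemma has_code_cons n r W c : 2 <= n -> letters 1 n.-1 r -> has_code n W c ->
  exists2 c', has_code n (r :: W) c' & lt_right c c'.
Proof.
elim/ltn_ind: n r W c => n IH r W c; rewrite leq_eqVlt => /orP [/eqP <-|n2 rL].
  move=> rL /has_code2P [a [-> ->]]; exists (Code2 a.+1); last by constructor.
  have -> : r = 1 by move: rL; rewrite /letters; lia.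
  exact: (has_code2 a.+1).
move=> /(has_codeP _ _ n2) [us [C [-> -> tC]]].
have [j Sr] := slot_cover (size us) n2 rL; set k := _ + j in Sr.
have uk : size us <= k by apply: leq_addr.
have [_ ck] := tC k; rewrite nth_default //= in ck.
have [||c' cr' lt_c'] :=
  IH _ (slot_strands_lt k n2) (slot_map n k r) _ _ _ _ ck.
- exact: slot_strands_ge2.
- have := @relabel_letters _ _ _ (relabels_slot k n2) [:: r].
  by rewrite /= !andbT; apply.
exists (CodeSeq (fun i => if i == k then c' else C i)).
  apply/(has_codeP _ _ n2);
    exists (set_nth [::] us k [:: r]), (fun i => if i == k then c' else C i).
  split=> //; first by rewrite tower_word_set_nth.
  move=> i; rewrite nth_set_nth /=; case: eqP => [->|_]; last exact: tC.
  by rewrite /= Sr.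
apply: (@lt_rightS _ _ k); last by rewrite eqxx.
by move=> i ik; rewrite ifF //; lia.
Qed.

Lemma has_code_cat n (x W : word) c : 2 <= n -> all (letters 1 n.-1) x ->
  has_code n W c ->
  exists2 c', has_code n (x ++ W) c' & x = [::] /\ c' = c \/ lt_right c c'.
Proof.
move=> n2; elim: x => [|r x IHx] /= => [_ cW|/andP [rL xL] cW];
  first by exists c; [|left].
have [c' cx cc'] := IHx xL cW; have [c'' crx c'c''] := has_code_cons n2 rL cx.
exists c'' => //; right; case: cc' => [[_ <-] //|lt_c].
exact: lt_right_trans lt_c c'c''.
Qed.

(** A greatest code, not only one that no other exceeds, so that uniqueness
    does not require the codes of a braid to be compared with one another. *)
Definition code_maximal (n : nat) (W : word) (c : code) : Prop :=
  has_code n W c /\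
  forall W' c', W' ==+ W -> has_code n W' c' -> c' = c \/ lt_right c' c.

Definition code_normal (n : nat) (W : word) : Prop :=
  exists c, code_maximal n W c.

Lemma code_normal_unique n W W' :
  2 <= n -> code_normal n W -> code_normal n W' -> W ==+ W' -> W = W'.
Proof.
move=> n2 [c [cW cmax]] [c' [cW' cmax']] WW'.
have [E|cc'] := cmax W' c' (peq_sym WW') cW'.
  by subst c'; apply: has_code_inj cW cW'.
have [E|c'c] := cmax' W c WW' cW; first by subst c'; apply: has_code_inj cW cW'.
by case: (lt_right_neq (lt_right_trans cc' c'c)).
Qed.

Definition normal_tower (n : nat) (us : seq word) : Prop :=
  greedy (slot_letters n) us /\
  forall k, code_normal (slot_strands n k) (map (slot_map n k) (nth [::] us k)).

(** Take another tower of an equivalent word, and the weightiest entry where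
    the codes differ. To its right the words are equal, so the remainders are
    equivalent and the word of the other tower divides the greedy one; if it is
    a proper divisor its code is smaller by [has_code_cat], and otherwise by
    the choice of the spelling in the greedy tower. *)
Lemma normal_tower_code_normal n us :
  2 < n -> normal_tower n us -> code_normal n (tower_word us).
Proof.
move=> n2 [gus /choice [C CP]].
have Su k : all (slot_letters n k) (nth [::] us k) by case: (gus k).
exists (CodeSeq C); split.
  by apply/(has_codeP _ _ n2); exists us, C; split=> // k; split=> //;
    case: (CP k).
move=> W' c' us'us /(has_codeP _ _ n2) [us' [C' [c'E W'E tC']]]; subst c' W'.
have [eqC|/existsNP neC] := pselect (forall k, C' k = C k).
  by left; congr CodeSeq; apply: funext.
right.
have [k neqk eqk] : exists2 k, C' k <> C k & forall l, l < k -> C' l = C l.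
  have exk : exists k, `[< C' k <> C k >] by case: neC => k ?; exists k;
    apply/asboolP.
  case: (ex_minnP exk) => k /asboolP neqk kmin; exists k => // l lk.
  apply: contrapT => /asboolP /kmin; lia.
apply: (@lt_rightS _ _ k) => //.
have [Su' cu'] := tC' k; have [cu cmax] := CP k.
have eql l : l < k -> nth [::] us' l ==+ nth [::] us l.
  move=> lk; have [Sl cl] := tC' l; have [cl' _] := CP l.
  rewrite eqk // in cl.
  rewrite (relabel_inj (relabels_slot l n2) Sl (Su l)) //.
  by apply: has_code_inj cl cl'; apply: slot_strands_ge2.
have [_ _ wmax] := gus k.
have [//||x uE] := wmax (nth [::] us' k).
  rewrite -(tower_word_eq_prefix eql us'us) tower_word_drop; exact: rdvd_catl.
have Sx := rdvd_all (Su k) uE.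
have relk := relabels_slot k n2.
have muE := relabel_peq relk (Su k) uE; rewrite map_cat in muE.
have [d cd] := has_code_cat (slot_strands_ge2 k n2) (relabel_letters relk Sx)
  cu'.
have [->|dC] := cmax _ d (peq_sym muE) cd; first by case=> [[_ /esym]|].
by case=> [[_ <-] //|lt_d]; apply: lt_right_trans lt_d dC.
Qed.

Lemma code_normal_nseq a : code_normal 2 (nseq a 1).
Proof.
exists (Code2 a); split; first exact: has_code2.
move=> W' c' /peq_size sz /has_code2P [b [W'E ->]]; move: sz; rewrite W'E.
by rewrite !size_nseq => ->; left.
Qed.

Lemma word2E (W : word) : all (letters 1 1) W -> W = nseq (size W) 1.
Proof.
move=> WL; apply/all_pred1P; apply: sub_all WL => r.
by rewrite /letters /=; lia.
Qed.

(** A greedy sequence of divisors exists, and each of them is respelled by a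
    word of greatest code on fewer strands; the tower itself is recorded
    because the comparison with the alternate normal form starts from it. *)
Theorem code_normal_exists n (b : word) : 2 <= n -> all (letters 1 n.-1) b ->
  exists W, W ==+ b /\ code_normal n W /\
    (2 < n -> exists2 us, W = tower_word us & normal_tower n us).
Proof.
elim/ltn_ind: n b => n IH b; rewrite leq_eqVlt => /orP [/eqP <-|n2 bL].
  by move=> /word2E ->; exists (nseq (size b) 1); split=> //; split=> //;
    apply: code_normal_nseq.
have [us [bus gus]] := @greedy_exists _ (slot_letters n) b
  (fun k r => @slot_cover n k r n2) bL.
have Su k : all (slot_letters n k) (nth [::] us k) by case: (gus k).
have /choice [V VP] : forall k, exists V, [/\ all (slot_letters n k) V,
    V ==+ nth [::] us k & code_normal (slot_strands n k)
      (map (slot_map n k) V)].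
  move=> k; have relk := relabels_slot k n2.
  have [W [Wu [nW _]]] := IH _ (slot_strands_lt k n2) _ (slot_strands_ge2 k n2)
    (relabel_letters relk (Su k)).
  have [|V SV VW] := relabel_surj relk (w := W).
    by rewrite (peq_all _ Wu) (relabel_letters relk).
  exists V; split=> //; last by rewrite VW.
  by apply: (relabel_peq_inj relk) => //; rewrite VW.
pose vs := mkseq V (size us).
have vu k : nth [::] vs k ==+ nth [::] us k.
  case: (ltnP k (size us)) => ku; last by rewrite !nth_default ?size_mkseq.
  by rewrite nth_mkseq //; case: (VP k).
have vsE k : nth [::] vs k = V k.
  case: (ltnP k (size us)) => ku; first by rewrite nth_mkseq.
  rewrite nth_default ?size_mkseq //; apply/esym/peq_nil.
  by have [_ Vu _] := VP k; rewrite nth_default in Vu.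
have dropE k : tower_word (drop k vs) ==+ tower_word (drop k us).
  by apply: tower_word_peq => i; rewrite !nth_drop.
have nvs : normal_tower n vs.
  split=> k; last by rewrite vsE; case: (VP k).
  apply: (wedge_peq (b:=tower_word (drop k us)) (g:=nth [::] us k)) => //.
  - by rewrite vsE; case: (VP k).
  - by symmetry.
  - by symmetry.
exists (tower_word vs); split; last first.
  by split=> [|_]; [apply: normal_tower_code_normal|exists vs].
by rewrite bus; have := dropE 0; rewrite !drop0.
Qed.

(** * The alternate normal form, and its comparison with maximal codes *)

(** The alternate normal form as a property of words: in a normal word the
    factors represent the alternate decomposition of its braid. *)
Fixpoint Phi_word (n : nat) (W : word) : Prop :=
  match n with
  | 0 => False
  | n'.+1 =>
      if n' == 1 then exists p, W = nseq p 1
      else exists us, [/\ W = tower_word us, greedy (alt_letters n'.+1) us &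
        forall k, k < size us ->
          Phi_word n' [seq alt_letter_id n'.+1 k r | r <- nth [::] us k]]
  end.

Lemma Phi_wordP n W : 2 < n -> Phi_word n W <->
  exists us, [/\ W = tower_word us, greedy (alt_letters n) us &
    forall k, k < size us ->
      Phi_word n.-1 [seq alt_letter_id n k r | r <- nth [::] us k]].
Proof. by case: n => [|[|[|n]]]. Qed.

Lemma Phi_word_nil n : 2 <= n -> Phi_word n [::].
Proof.
rewrite leq_eqVlt => /orP [/eqP <-|n2]; first by exists 0.
apply/(Phi_wordP _ n2); exists [::]; split=> // k; rewrite nth_nil.
exact: wedge_nil.
Qed.

Lemma Phi_word_unique n W W' : 2 <= n ->
  Phi_word n W -> Phi_word n W' -> W ==+ W' -> W = W'.
Proof.
elim: n W W' => // n IH W W'; rewrite leq_eqVlt => /orP [/eqP <-|n2].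
  by move=> [p ->] [q ->] /peq_size; rewrite !size_nseq => ->.
move=> /(Phi_wordP _ n2) [us [-> gu nu]] /(Phi_wordP _ n2) [vs [-> gv nv]] uv.
have eqk := greedy_unique gu gv uv.
apply: tower_word_ext => k; have [Su _ _] := gu k; have [Sv _ _] := gv k.
have relk := relabels_alt k n2; have := eqk k.
case: (ltnP k (size us)) => ku; last first.
  by rewrite (nth_default _ ku) => /peq_sym /peq_nil.
case: (ltnP k (size vs)) => kv; last first.
  by rewrite (nth_default _ kv) => /peq_nil.
move=> ekk; apply: (relabel_inj relk) => //.
apply: (IH _ _ _ (nu k ku) (nv k kv)); first by rewrite -ltnS.
exact: (relabel_peq relk).
Qed.

Lemma relabel_rdvd A N f b g : relabels A N f -> all A b ->
  rdvd g b -> rdvd (map f g) (map f b).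
Proof.
move=> relf Ab [x bx]; exists (map f x); rewrite -map_cat.
exact: (relabel_peq relf).
Qed.

Lemma relabel_rdvd_inj A N f b g : relabels A N f -> all A b -> all A g ->
  rdvd (map f g) (map f b) -> rdvd g b.
Proof.
move=> relf Ab Ag [x' bx'].
have := relabel_letters relf Ab;
  rewrite (peq_all _ bx') all_cat => /andP [xL _].
have [x Ax xE] := relabel_surj relf xL; exists x.
by apply: (relabel_peq_inj relf) => //; rewrite ?all_cat ?Ax // map_cat xE.
Qed.

Lemma wedge_relabel (A S S' : pred nat) N f b g :
  relabels A N f -> (forall r, A r -> S' (f r) = S r) ->
  (forall r, S' r -> letters 1 N.-1 r) ->
  all A b -> all A g -> wedge S b g -> wedge S' (map f b) (map f g).
Proof.
move=> relf SS' S'L Ab Ag [Sg gb gmax].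
have Smap u : all A u -> all S' (map f u) = all S u.
  by move=> Au; rewrite all_map; apply: eq_in_all => r /(allP Au) /SS'.
split; [by rewrite Smap|exact: (relabel_rdvd relf)|].
move=> h' Sh' h'b; have hL : all (letters 1 N.-1) h' by apply: sub_all Sh'.
have [h Ah hE] := relabel_surj relf hL; rewrite -hE in Sh' h'b *.
rewrite Smap // in Sh'.
by apply: (relabel_rdvd relf) => //; apply: gmax => //;
  apply: (relabel_rdvd_inj relf).
Qed.

Lemma wedge_suffix S x b g : wedge S (x ++ b) g -> rdvd g b -> wedge S b g.
Proof.
move=> [Sg _ gmax] gb; split=> // h Sh hb; apply: gmax => //.
exact: rdvd_trans hb (rdvd_catl _ _).
Qed.

(** What divides the remainder after slot [k] and uses the letters of this slot
    would have been taken in this slot. *)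
Lemma greedy_next_trivial S us k h : greedy S us -> all (S k) h ->
  rdvd h (tower_word (drop k.+1 us)) -> h = [::].
Proof.
move=> gus Sh [x xE]; have [Su _ umax] := gus k.
have [||y] := umax (h ++ nth [::] us k); first by rewrite all_cat Sh.
  by exists x; rewrite tower_word_drop xE catA.
by move/peq_size; rewrite !size_cat => ?; apply: size0nil; lia.
Qed.

Lemma normal_tower_ext n us vs : (forall k, nth [::] us k = nth [::] vs k) ->
  normal_tower n us -> normal_tower n vs.
Proof.
move=> uv [gu nu]; split=> k; last by rewrite -uv.
have -> : tower_word (drop k vs) = tower_word (drop k us).
  by apply: tower_word_ext => i; rewrite !nth_drop uv.
by rewrite -uv.
Qed.

Lemma has_code_positive n W c : 2 <= n -> has_code n W c ->
  all (letters 1 n.-1) W.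
Proof.
rewrite leq_eqVlt => /orP [/eqP <- /has_code2P [a [-> _]]|n2].
  by rewrite all_nseq orbT.
move=> /(has_codeP _ _ n2) [us [C [_ -> tC]]]; apply: tower_word_all => k.
by have [Su _] := tC k; apply: sub_all Su => r; apply: slot_letters_positive.
Qed.

Lemma code_normal_tower n W : 2 < n -> code_normal n W ->
  exists us, [/\ W = tower_word us, normal_tower n us & n <= size us].
Proof.
move=> n2 nW; have [c [/(has_code_positive (ltnW n2)) WL _]] := nW.
have [W' [WW' [nW' /(_ n2) [us W'E tus]]]] := code_normal_exists (ltnW n2) WL.
exists (mkseq (nth [::] us) (size us + n)); split;
  last by rewrite size_mkseq leq_addl.
  rewrite tower_word_pad ?leq_addr // -W'E.
  by apply: (code_normal_unique _ nW nW'); [apply: ltnW|apply: peq_sym].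
apply: normal_tower_ext tus => k.
case: (ltnP k (size us + n)) => kn; first by rewrite nth_mkseq.
by rewrite !nth_default ?size_mkseq // (leq_trans _ kn) ?leq_addr.
Qed.

Lemma tower_word_rcons us u : tower_word (rcons us u) = u ++ tower_word us.
Proof. by rewrite -cats1 tower_word_cat tower_word_cons. Qed.

Lemma tower_word_map f us : tower_word (map (map f) us) = map f (tower_word us).
Proof. by rewrite /tower_word -map_rev map_flatten. Qed.

Lemma nth_take_default (T : Type) (x : T) s n k : n <= k ->
  nth x (take n s) k = x.
Proof. by move=> nk; rewrite nth_default // (leq_trans _ nk) // size_take_min
  geq_minl. Qed.

Lemma slot_letters_first_factor n k r : k <= n - 2 -> slot_letters n k r ->
  alt_letters n 0 r.
Proof.
rewrite /slot_letters /alt_letters /=; case: ltnP => kn k2;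
  first by rewrite /letters; lia.
by rewrite (_ : k - (n - 2) = 0) //; lia.
Qed.

Section FirstFactor.
Variables (n : nat) (us : seq word).
Hypotheses (n2 : 2 < n) (tus : normal_tower n us) (us_n : n <= size us).

Lemma slot_word_all k : all (slot_letters n k) (nth [::] us k).
Proof. by case: tus => gus _; case: (gus k). Qed.

Lemma first_factor_letters : all (alt_letters n 0) (tower_word (take n.-1 us)).
Proof.
apply: tower_word_all => k; case: (ltnP k n.-1) => kn; last first.
  by rewrite nth_take_default.
rewrite nth_take //; apply: sub_all (slot_word_all k) => r.
by apply: slot_letters_first_factor; lia.
Qed.

(** The slots n-3 and n-2, which hold X_1 and A_0, use the same letters 2 to
    n-1. *)
Lemma middle_slot_trivial : nth [::] us (n - 2) = [::].
Proof.
have [gus _] := tus; have := slot_word_all (n - 2);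
  rewrite /slot_letters ltnn subnn.
move=> Su; apply: (greedy_next_trivial (k := n - 3) gus).
  have -> : slot_letters n (n - 3) = alt_letters n 0.
    rewrite /slot_letters ifT; last lia.
    by rewrite (_ : n.-1 - (n - 3) = 2) //; lia.
  by [].
rewrite (_ : (n - 3).+1 = n - 2); last lia.
by rewrite tower_word_drop; apply: rdvd_catl.
Qed.

(** If the wedge were larger than the product of the slots 0 to n-2, the excess
    would divide what slot n-2 leaves, in the letters of that slot. *)
Lemma first_factor_wedge :
  wedge (alt_letters n 0) (tower_word us) (tower_word (take n.-1 us)).
Proof.
have [gus _] := tus; set V := tower_word (take _ _).
have WE : tower_word us = tower_word (drop n.-1 us) ++ V.
  by rewrite -{1}(cat_take_drop n.-1 us) tower_word_cat.
have [b bW] := wedge_exists (alt_letters n 0) (tower_word us).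
have [Sb [y yE] bmax] := bW.
have [||x xE] := bmax V; first exact: first_factor_letters.
  by rewrite WE; apply: rdvd_catl.
have yx : tower_word (drop n.-1 us) ==+ y ++ x.
  by apply: (@peq_cancelr _ _ V); rewrite -WE yE xE catA.
suff x0 : x = [::].
  apply: wedge_peq bW => //; first exact: first_factor_letters.
  by rewrite xE x0.
apply: (greedy_next_trivial (k := n - 2) gus).
  have -> : slot_letters n (n - 2) =
    alt_letters n 0 by rewrite /slot_letters ltnn subnn.
  exact: rdvd_all Sb xE.
by exists y; rewrite (_ : (n - 2).+1 = n.-1) //; lia.
Qed.

(** For n = 3 only slot 0 is involved. For n > 3 a greedy tower on n-1 strands
    is built for the shifted factor: its slots below n-3 are those of [us], and
    its other slots are those of a tower [ts] of the word in slot n-3 of [us].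
    They fit together because this word has no right divisor in the letters of
    slot n-4, so the slots of [ts] below n-3 are empty. *)
Lemma first_factor_normal :
  code_normal n.-1 (map Sh (tower_word (take n.-1 us))).
Proof.
have [gus nus] := tus.
have -> : tower_word (take n.-1 us) = tower_word (take (n - 2) us).
  rewrite (_ : n.-1 = (n - 2).+1); last lia.
  rewrite (take_nth [::]); last by apply: leq_trans us_n; lia.
  by rewrite tower_word_rcons middle_slot_trivial.
have top : tower_word (take (n - 2) us) =
    nth [::] us (n - 3) ++ tower_word (take (n - 3) us).
  rewrite [in LHS](_ : n - 2 = (n - 3).+1); last lia.
  rewrite (take_nth [::]); last by apply: leq_trans us_n; lia.
  exact: tower_word_rcons.
have := nus (n - 3); rewrite /slot_map ifT; last lia.
rewrite /slot_strands (_ : minn _ _ = n.-1); last lia.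
rewrite (_ : map _ _ = map Sh (nth [::] us (n - 3))); last first.
  by apply: eq_map => r; rewrite /Sh -subn1; congr (r - _); lia.
have [n3|n3] := leqP n 3.
  by rewrite top (_ : n - 3 = 0) ?take0 ?cats0 //; lia.
have N2 : 2 < n.-1 by lia.
move=> /(code_normal_tower N2) [ts [tsE [gts nts] ts_N]].
have relSh : relabels (alt_letters n 0) n.-1 Sh := relabels_alt 0 n2.
have us_letters k : k < n - 2 -> all (alt_letters n 0) (nth [::] us k).
  move=> kn; apply: sub_all (slot_word_all k) => r;
    apply: slot_letters_first_factor; lia.
have ts_all k : all (slot_letters n.-1 k) (nth [::] ts k) by case: (gts k).
have slotE k r : k < n - 3 -> letters 2 n.-1 r ->
    slot_letters n.-1 k (Sh r) = slot_letters n k r.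
  move=> kn; rewrite /slot_letters !ifT; [|lia..].
  by rewrite /letters /Sh; lia.
(* The low slots of [ts] multiply to a right divisor of the word in slot n-3,
   in letters that slot n-4 has exhausted. *)
have ts0 : tower_word (take (n - 3) ts) = [::].
  set h := tower_word _.
  have Lh : all (letters 2 n.-2) h.
    apply: tower_word_all => k; case: (ltnP k (n - 3)) => kn; last first.
      by rewrite nth_take_default.
    rewrite nth_take //; apply: sub_all (ts_all k) => r.
    by rewrite /slot_letters ifT; [rewrite /letters; lia|lia].
  have [|u Au uh] := relabel_surj relSh (w := h).
    by apply: sub_all Lh => r; rewrite /letters; lia.
  suff u0 : u = [::] by rewrite -uh u0.
  apply: (greedy_next_trivial (k := n - 4) gus).
    apply/allP=> r ru; have := allP Au r ru; have := allP Lh (Sh r).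
    rewrite -uh map_f // => /(_ isT); rewrite /slot_letters ifT; last lia.
    by rewrite /alt_letters /letters /Sh /=; lia.
  rewrite (_ : (n - 4).+1 = n - 3); last lia.
  rewrite tower_word_drop; apply: rdvd_trans (rdvd_catl _ _).
  apply: (relabel_rdvd_inj relSh) => //; first by apply: us_letters; lia.
  by rewrite uh tsE -{1}(cat_take_drop (n - 3) ts) tower_word_cat;
    apply: rdvd_catl.
have ts_top : map Sh (nth [::] us (n - 3)) = tower_word (drop (n - 3) ts).
  by rewrite tsE -{1}(cat_take_drop (n - 3) ts) tower_word_cat ts0 cats0.
pose ws := map (map Sh) (take (n - 3) us) ++ drop (n - 3) ts.
have sz : size (map (map Sh) (take (n - 3) us)) = n - 3.
  by rewrite size_map size_takel //; apply: leq_trans us_n; lia.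
have -> : map Sh (tower_word (take (n - 2) us)) = tower_word ws.
  by rewrite tower_word_cat tower_word_map top map_cat ts_top.
apply: normal_tower_code_normal => //; split=> k; last first.
  rewrite nth_cat sz; case: ltnP => kn; last by rewrite nth_drop subnKC.
  have := nus k; rewrite (nth_map [::]); last first.
    by rewrite size_takel //; apply: leq_trans us_n; lia.
  rewrite nth_take // /slot_strands (_ : minn k.+2 n.-1 = minn k.+2 n.-2);
    last lia.
  rewrite /slot_map !ifT; [|lia..].
  rewrite -map_comp; set V := map _ _; set V' := map _ _;
    suff -> : V = V' by [].
  by apply: eq_map => r; rewrite /= /Sh; lia.
case: (ltnP k (n - 3)) => kn; last first.
  rewrite drop_cat nth_cat sz ltnNge kn /= nth_drop drop_drop.
  by rewrite subnK // subnKC.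
rewrite drop_cat nth_cat sz kn (nth_map [::]); last first.
  by rewrite size_takel //; apply: leq_trans us_n; lia.
rewrite nth_take // -map_drop tower_word_cat -ts_top tower_word_map -map_cat.
set b := _ ++ _.
(* The wedge is known for the remainder, which has [b] as a right divisor. *)
have bE : tower_word (drop k us) = tower_word (drop (n - 2) us) ++ b.
  rewrite /b -{1}(cat_take_drop (n - 3) us) drop_cat size_takel; last first.
    by apply: leq_trans us_n; lia.
  rewrite kn tower_word_cat tower_word_drop -catA.
  by rewrite (_ : (n - 3).+1 = n - 2) //; lia.
have Ab : all (alt_letters n 0) b.
  rewrite all_cat us_letters; last lia.
  apply: tower_word_all => i; rewrite nth_drop.
  case: (ltnP (k + i) (n - 3)) => ki; last by rewrite nth_take_default.
  by rewrite nth_take // us_letters //; lia.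
apply: (wedge_relabel relSh (S := slot_letters n k)) => //.
- by move=> r; apply: slotE.
- by move=> r; apply: slot_letters_positive.
- by apply: us_letters; lia.
apply: (wedge_suffix (x := tower_word (drop (n - 2) us))); first by rewrite -bE.
rewrite /b tower_word_drop nth_take //.
apply: rdvd_trans (rdvd_catl _ _); exact: rdvd_catl.
Qed.
End FirstFactor.

(** The factors to the left of the first one are single slots of the greedy
    tower, with the same letters and the same relabelling; the first one is
    covered by [first_factor_wedge] and [first_factor_normal]. *)
Theorem code_normal_Phi n W : 2 <= n -> code_normal n W -> Phi_word n W.
Proof.
elim: n W => // n IH W; rewrite leq_eqVlt => /orP [/eqP <-|n2].
  by move=> [c [/has_code2P [a [-> _]] _]]; exists a.
move=> /(code_normal_tower n2) [us [-> tus us_n]]; have [gus nus] := tus.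
apply/(Phi_wordP _ n2); exists (tower_word (take n us) :: drop n us); split.
- by rewrite tower_word_cons -[LHS](congr1 _ (cat_take_drop n us))
  tower_word_cat.
- case=> [|k].
    rewrite drop0 tower_word_cons -tower_word_cat cat_take_drop.
    exact: first_factor_wedge.
  rewrite /= drop_drop (addnC k) nth_drop; have := gus (n + k).
  rewrite /slot_letters ifF; last lia.
  by rewrite (_ : n + k - (n.+1 - 2) = k.+1) //; lia.
- move=> [_|k _]; first by apply: IH;
  [lia|exact: (first_factor_normal n2 tus us_n)].
  have kE : n + k - (n.+1 - 2) = k.+1 by lia.
  have mE : minn (n + k).+2 n.+1.-1 = n by lia.
  have := nus (n + k); rewrite /slot_strands /slot_map mE ifF; last lia.
  by rewrite kE -nth_drop; apply: IH; lia.
Qed.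

(** * Back to the braid group *)

Lemma submonoid_quotP n (S : pred nat) b w :
  (forall r, S r -> letters 1 n.-1 r) ->
  all (letters 1 n.-1) b -> all (letters 1 n.-1) w ->
  submonoid S (word_braid n b * (word_braid n w)^-1)%g <->
  exists2 x, all S x & b ==+ x ++ w.
Proof.
move=> SL bL wL; split=> -[x Sx xE]; exists x => //.
  apply: (@word_braid_inj n) => //.
    by rewrite all_cat wL andbT; apply: sub_all Sx.
  by rewrite word_braid_cat -xE mulgVK.
by rewrite (peq_word_braid bL xE) word_braid_cat mulgK.
Qed.

Lemma positive_quotP n b w :
  all (letters 1 n.-1) b -> all (letters 1 n.-1) w ->
  positive_braid (word_braid n b * (word_braid n w)^-1)%g <-> rdvd w b.
Proof.
move=> bL wL; split=> [/submonoid_quotP [] // x _ bx|[x bx]]; first by exists x.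
by apply/submonoid_quotP => //; exists x => //; apply: rdvd_all bL bx.
Qed.

Lemma is_wedgeP n (S : pred nat) b w :
  (forall r, S r -> letters 1 n.-1 r) -> all (letters 1 n.-1) b -> all S w ->
  is_wedge S (word_braid n b) (word_braid n w) <-> wedge S b w.
Proof.
move=> SL bL Sw; have LS u : all S u ->
  all (letters 1 n.-1) u by apply: sub_all.
have wL := LS w Sw; split=> [[_ /(positive_quotP bL wL) wb wmax]|[_ wb wmax]].
  split=> // h Sh /(positive_quotP bL (LS h Sh)) hb.
  have /(submonoid_quotP SL wL (LS h Sh)) [x _ xE] : submonoid S
      (word_braid n w * (word_braid n h)^-1)%g by apply: wmax => //; exists h.
  by exists x.
split; [by exists w|exact/(positive_quotP bL wL)|].
move=> _ [h Sh ->] /(positive_quotP bL (LS h Sh)) /(wmax h Sh) [x wx].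
by apply/(submonoid_quotP SL wL (LS h Sh)); exists x => //;
  apply: rdvd_all Sw wx.
Qed.

Lemma word_braid_nseq n p r : word_braid n (nseq p r) = (sigma n r ^+ p)%g.
Proof.
elim: p => [|p IHp]; first by rewrite /word_braid big_nil.
by rewrite /word_braid big_cons -/(word_braid n _) IHp expgS.
Qed.

Lemma word_braid_flatten n (V : nat -> word) s :
  word_braid n (flatten [seq V i | i <- s]) =
    (\prod_(i <- s) word_braid n (V i))%g.
Proof.
elim: s => [|i s IHs]; first by rewrite /word_braid !big_nil.
by rewrite big_cons /= word_braid_cat IHs.
Qed.

Lemma word_braid_drop n us k :
  (word_braid n (tower_word us) *
     \prod_(0 <= j < k) (word_braid n (nth [::] us j))^-1)%g =
  word_braid n (tower_word (drop k us)).
Proof.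
elim: k => [|k IHk]; first by rewrite big_geq // mulg1 drop0.
by rewrite big_nat_recr //= mulgA IHk tower_word_drop word_braid_cat mulgK.
Qed.

Lemma tower_word_mkseqE V m :
  tower_word (mkseq V m) = flatten [seq V i | i <- rev (iota 0 m)].
Proof. by rewrite /tower_word /mkseq map_rev. Qed.

Lemma alt_letters_positive n i r : 2 < n -> alt_letters n i r ->
  letters 1 n.-1 r.
Proof. by move=> n2 /(alt_letters_bound n2); rewrite /letters; lia. Qed.

Lemma is_PhiS n (beta : braid_group n.+1) W : 2 < n.+1 ->
  is_Phi_normal_form beta W <->
  exists (m : nat) (b : nat -> braid_group n.+1)
         (g : nat -> braid_group n) (V : nat -> word),
    [/\ alternate_decomposition beta m b,
        forall i, i <= m -> alt_identified i (b i) (g i),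
        forall i, i <= m -> all (alt_letters n.+1 i) (V i),
        forall i, i <= m -> is_Phi_normal_form (g i)
          [seq alt_letter_id n.+1 i r | r <- V i] &
        W = flatten [seq V i | i <- rev (iota 0 m.+1)]].
Proof. by case: n beta => [|[|n]]. Qed.

(** The normal word of a factor is known to represent it only after
    relabelling; since relabelling reflects equivalence, it represents the
    factor itself. *)
Lemma is_Phi_normal_formP n (beta : braid_group n) W : 2 <= n ->
  is_Phi_normal_form beta W <-> Phi_word n W /\ word_braid n W = beta.
Proof.
elim: n beta W => // n IH beta W; rewrite leq_eqVlt => /orP [/eqP [n1]|n2].
  subst n; split=> [[p [-> ->]]|[[p ->] <-]]; last by exists p;
    rewrite word_braid_nseq.
  by split; [exists p|rewrite word_braid_nseq].
have n2' : 2 <= n by rewrite -ltnS.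
rewrite is_PhiS // Phi_wordP //; split.
  move=> [m [b [g [V [[betaE bw] idb VA phiV WE]]]]].
  have bE i : i <= m -> b i = word_braid n.+1 (V i).
    move=> im; have [_ gE] := (IH _ _ n2').1 (phiV i im).
    have [u [uA -> guE]] := idb i im; have reli := relabels_alt i n2.
    apply: peq_word_braid.
      by apply: sub_all uA => r; apply: alt_letters_positive.
    apply: (relabel_peq_inj reli) => //; first exact: VA.
    apply: (@word_braid_inj n); last by rewrite gE.
      exact: (relabel_letters reli).
    exact: (relabel_letters reli (VA i im)).
  have wW : word_braid n.+1 W = beta.
    rewrite WE word_braid_flatten betaE; apply: eq_big_seq => i.
    by rewrite mem_rev mem_iota => /andP [_ im]; rewrite bE.
  split=> //; exists (mkseq V m.+1); rewrite tower_word_mkseqE; split=> //.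
    move=> k; case: (ltnP k m.+1) => km; last first.
      rewrite drop_oversize ?nth_default ?size_mkseq //; exact: wedge_nil.
    have nthE j : j <= m -> nth [::] (mkseq V m.+1) j = V j by move=> jm;
      rewrite nth_mkseq.
    apply/(@is_wedgeP n.+1).
    + by move=> r; apply: alt_letters_positive.
    + apply: tower_word_all => j; rewrite nth_drop.
      case: (ltnP (k + j) m.+1) => kj; last by rewrite nth_default ?size_mkseq.
      rewrite nthE //; apply: sub_all (VA _ kj) => r;
        exact: alt_letters_positive.
    + by rewrite nthE //; apply: VA.
    rewrite -word_braid_drop tower_word_mkseqE -WE wW nthE // -bE //.
    rewrite (eq_big_nat _ _ (F2 := fun j => (b j)^-1)%g); first exact: bw.
    move=> j /andP [_ jk]; have jm : j <= m by lia.
    by rewrite nthE ?bE.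
  move=> k; rewrite size_mkseq => km; rewrite nth_mkseq //.
  by have [] := (IH _ _ n2').1 (phiV k km).
case=> [[us [-> gus nus]] <-]; set m := size us.
have usA k : all (alt_letters n.+1 k) (nth [::] us k) by case: (gus k).
have WE : tower_word us = flatten [seq nth [::] us i | i <- rev (iota 0 m.+1)].
  by rewrite -tower_word_mkseqE tower_word_pad // leqnSn.
exists m, (fun i => word_braid n.+1 (nth [::] us i)),
  (fun i => word_braid n [seq alt_letter_id n.+1 i r | r <- nth [::] us i]),
  (nth [::] us); split=> //.
- split=> [|i im]; first by rewrite [in LHS]WE word_braid_flatten.
  rewrite word_braid_drop; apply/is_wedgeP => //.
    by move=> r; apply: alt_letters_positive.
  apply: tower_word_all => j; rewrite nth_drop; apply: sub_all (usA _) => r.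
  exact: alt_letters_positive.
- by move=> i _; exists (nth [::] us i).
move=> i _; apply/(IH _ _ n2'); split=> //.
case: (ltnP i m) => im; first exact: nus.
by rewrite nth_default //; apply: Phi_word_nil.
Qed.

Lemma Phi_word_positive n W : 2 <= n -> Phi_word n W -> all (letters 1 n.-1) W.
Proof.
rewrite leq_eqVlt => /orP [/eqP <- [p ->]|n2]; first by rewrite all_nseq orbT.
move=> /(Phi_wordP _ n2) [us [-> gus _]]; apply: tower_word_all => k.
by have [Su _ _] := gus k; apply: sub_all Su => r; apply: alt_letters_positive.
Qed.

(** A word of greatest code exists for every braid, so a code that none exceeds
    is greatest. *)
Lemma is_C_normal_formP n (beta : braid_group n) W : 2 <= n ->
  is_C_normal_form beta W <->
  [/\ all (letters 1 n.-1) W, word_braid n W = beta & code_normal n W].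
Proof.
move=> n2; split=> [[WL WE [c cW cmax]]|[WL WE [c [cW cmax]]]]; split=> //.
  have [V [VW [[d [dV dmax]] _]]] := code_normal_exists n2 WL.
  have VL : all (letters 1 n.-1) V by rewrite (peq_all _ VW).
  have [E|lt_cd] := dmax W c (peq_sym VW) cW.
    by rewrite E in cW; rewrite (has_code_inj n2 cW dV); exists d.
  by case: (cmax V d VL _ dV lt_cd); rewrite (peq_word_braid VL VW).
exists c => // W' c' WL' WE' cW' lt_cc'.
have [|E|lt_c'c] := cmax W' c' _ cW'.
- by apply: word_braid_inj WL' WL _; rewrite WE.
- by subst c'; apply: (lt_right_neq lt_cc').
- by apply: (lt_right_neq (lt_right_trans lt_cc' lt_c'c)).
Qed.

Theorem proposition3 (n : nat) (hn : 2 <= n) (beta : braid_group n)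
    (hbeta : positive_braid beta) :
  (exists! W : word, is_C_normal_form beta W) /\
  (forall W : word, is_C_normal_form beta W <-> is_Phi_normal_form beta W).
Proof.
have [b bL bE] := hbeta; have [W0 [W0b [nW0 _]]] := code_normal_exists hn bL.
have W0L : all (letters 1 n.-1) W0 by rewrite (peq_all _ W0b).
have W0E : word_braid n W0 = beta by rewrite bE (peq_word_braid W0L W0b).
have eqW0 W : all (letters 1 n.-1) W -> word_braid n W = beta -> W0 ==+ W.
  by move=> WL WE; apply: (@word_braid_inj n) => //; rewrite W0E WE.
split=> [|W].
  exists W0; split=> [|W]; first exact/is_C_normal_formP.
  move=> /(is_C_normal_formP _ _ hn) [WL WE nW].
  exact: code_normal_unique hn nW0 nW (eqW0 W WL WE).
rewrite is_C_normal_formP // is_Phi_normal_formP //;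
  split=> [[WL WE nW]|[nW WE]].
  by split=> //; apply: code_normal_Phi.
have WL := Phi_word_positive hn nW.
have -> : W = W0; last by [].
apply: (Phi_word_unique hn nW (code_normal_Phi hn nW0)).
exact/peq_sym/eqW0.
Qed.
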